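(* Let the array $\mathcal A$ be a disk of radius $a$, and let $N$ point-like scatterers be aligned in the range direction of $\mathcal A$: $\vec y_j=(y_*,L+\eta_j)$ with symmetric polarizability tensors $\boldsymbol\alpha_j\in\mathbb C^{3\times3}$, independent of frequency, $\|\boldsymbol\alpha_j\|=\mathcal O(1)$, $j=1,\dots,N$. Assume the Fraunhofer regime holds uniformly over the frequency band $[\omega_0-B/2,\omega_0+B/2]$. Then the image of the cross-range polarizability tensor $$\boldsymbol\alpha_{1:2,1:2}=\frac1B\int_{|\omega-\omega_0|<B/2}\boldsymbol\alpha_{1:2,1:2}(\omega)\,\mathrm d\omega$$ (which depends on the imaging point $\vec y$) satisfies the following estimates. (i) If the imaging point is a scatterer location, i.e. $\vec y=\vec y_i$, then $$\|\boldsymbol\alpha_{1:2,1:2}-\boldsymbol\alpha_{i;1:2,1:2}\|=\mathcal O\Big(\frac{c}{B\,\min_{j\ne i}|\eta_i-\eta_j|}\Big)+o(1).$$ (ii) If the imaging point range is different from any of the scatterer ranges, i.e. $\vec y=(y_*,L+\eta)\ne\vec y_j$ for all $j=1,\dots,N$, then $$\|\boldsymbol\alpha_{1:2,1:2}\|=\mathcal O\Big(\frac{c}{B\,\min_{j=1,\dots,N}|\eta-\eta_j|}\Big)+o(1).$$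
   Context: Notation. Points of $\mathbb R^3$ are written $\vec x=(x,z)$ with $x\in\mathbb R^2$ the cross-range part and $z$ the range part; $c>0$ is the wave speed, $\omega>0$ the angular frequency, $k=\omega/c$. With $\vec r=\vec x-\vec y$, $r=\|\vec r\|$, $m(kr)=(\mathrm i kr-1)/(kr)^2$, and $G(\vec x,\vec y;k)=\frac{e^{\mathrm i k\|\vec x-\vec y\|}}{4\pi\|\vec x-\vec y\|}$, the dyadic Green function is the $3\times3$ matrix $$\mathbb G(\vec x,\vec y;k)=G(\vec x,\vec y;k)\Big[(1+m(kr))\mathbb I-(1+3m(kr))\frac{\vec r\,\vec r^{\top}}{r^2}\Big].$$ Array, data, image. $\mathcal A=\{x_r\in\mathbb R^2:\|x_r\|\le a\}$ is an array of collocated receivers $\vec x_r=(x_r,0)$ and sources $\vec x_s=(x_s,0)$, $x_r,x_s\in\mathcal A$. The data are the array response function (Born approximation) $\Pi(x_r,x_s;k)=\sum_{n=1}^N\mathbb G(\vec x_r,\vec y_n;k)\,\boldsymbol\alpha_n\,\mathbb G(\vec y_n,\vec x_s;k)$; the active Kirchhoff imaging function is $$\mathbb I_{\mathrm{KM}}(\vec y;k)=\int_{\mathcal A}\int_{\mathcal A}\overline{\mathbb G(\vec x_r,\vec y;k)}\,\Pi(x_r,x_s;k)\,\overline{\mathbb G(\vec x_s,\vec y;k)}\,\mathrm dx_r\,\mathrm dx_s\in\mathbb C^{3\times3}.$$ Let $\mathbb H(\vec y,\vec y';k)=\int_{\mathcal A}\overline{\mathbb G(\vec x_r,\vec y;k)}\,\mathbb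 G(\vec x_r,\vec y';k)\,\mathrm dx_r$. The subscript $1{:}2,1{:}2$ on a $3\times3$ matrix denotes its leading $2\times2$ principal block. The single-frequency estimate at imaging point $\vec y$ and frequency $\omega$ is $$\boldsymbol\alpha_{1:2,1:2}(\omega)=\mathbb H_{1:2,1:2}\big(\vec y,\vec y;\tfrac\omega c\big)^{-1}\,\mathbb I_{\mathrm{KM};1:2,1:2}\big(\vec y;\tfrac\omega c\big)\,\mathbb H_{1:2,1:2}\big(\vec y,\vec y;\tfrac\omega c\big)^{-1},$$ considered sufficiently far into the Fraunhofer regime, where the inverses exist. Fraunhofer regime. Imaging points and scatterer positions lie in the imaging window: they are of the form $(y,L+\eta)$ with $\|y\|=\mathcal O(b)$ and $|\eta|=\mathcal O(h)$. Put $\Theta_a=ka^2/L$, $\Theta_b=kb^2/L$, $\Theta_h=kh^2/L$. The parameters vary so that $kL\gg1$, $a\ll L$, $b\ll L$, $h\ll L$, $\Theta_b\ll1$, $1\ll\Theta_a\ll L^2/a^2$ and $kh=\mathcal O(1)$, where $X\ll Y$ means $X/Y\to0$, all of this uniformly for $k=\omega/c$ with $\omega\in[\omega_0-B/2,\omega_0+B/2]$; $N$ is fixed and the $\eta_j$ are distinct. The symbols $\mathcal O$, $o$ refer to this limit, uniformly over points of the imaging window. The term with $\min_{j\ne i}$ is absent if $N=1$. *)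

(* Defs.v *)
From HB Require Import structures.
From mathcomp Require Import all_boot all_order all_algebra.
From mathcomp Require Import complex.
From mathcomp Require Import all_classical all_reals all_analysis.

Set Implicit Arguments.
Unset Strict Implicit.
Unset Printing Implicit Defensive.

Import Order.TTheory GRing.Theory Num.Theory.
Import numFieldNormedType.Exports.

Local Open Scope classical_set_scope.
Local Open Scope ring_scope.
Local Open Scope complex_scope.

Section Asymptotics.

(* The asymptotic regime is a filter [F] on an arbitrary type [T] indexing the
   parameter families. A property holds near [uniformly F D] when, near [F], it
   holds at [(t, s)] for all [s] in [D t] at once, so limits, O and o along
   [uniformly F D] are those along [F], uniform over [D]. *)
Definition uniformly (T S : Type) (F : set_system T) (D : T -> set S) :
    set_system (T * S) :=
  [set A | \forall t \near F, forall s, D t s -> A (t, s)].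

Global Instance uniformly_filter (T S : Type) (F : set_system T)
  (D : T -> set S) : Filter F -> Filter (uniformly F D).
Proof.
move=> FF; split.
- by apply: (@filterE _ F FF).
- move=> P Q FP FQ; apply: (@filterS2 _ F FF _ _ _ _ FP FQ) => t HP HQ s Ds.
  by split; [exact: HP | exact: HQ].
- move=> P Q PQ FP; apply: (@filterS _ F FF _ _ _ FP) => t HP s Ds.
  by apply: PQ; exact: HP.
Qed.

Canonical uniformly_filter_on (T S : Type) (F : filter_on T)
  (D : T -> set S) := FilterType (uniformly F D) (uniformly_filter _ _).

Variable R : realType.

Definition much_less (S : Type) (G : set_system S) (X Y : S -> R) : Prop :=
  (fun p => X p / Y p) @ G --> (0 : R).

(* f = O(g) + o(1) *)
Definition O_plus_o1 (S : Type) (G : filter_on S) (f g : S -> R) : Prop :=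
  exists u v : S -> R,
    [/\ f = u \+ v, u =O_G g & v =o_G (fun=> 1 : R)].

Definition freq_band (omega0 B : R) : set R :=
  [set omega | omega0 - B / 2 <= omega <= omega0 + B / 2].

(* All relations between [k], [L], [a], [b], [h] are along pairs
   [p = (t, omega)], uniformly for [omega] in the frequency band. *)
Definition fraunhofer (T : Type) (F : filter_on T)
    (c omega0 B L a b h : T -> R) : Prop :=
  let G := uniformly_filter_on F (fun t => freq_band (omega0 t) (B t)) in
  let k (p : T * R) := p.2 / c p.1 in
  let lift (f : T -> R) (p : T * R) := f p.1 in
  let Theta (f : T -> R) (p : T * R) := k p * f p.1 ^+ 2 / L p.1 in
  [/\ much_less G (fun=> 1) (fun p => k p * L p.1),
      [/\ much_less G (lift a) (lift L),
          much_less G (lift b) (lift L) &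
          much_less G (lift h) (lift L)],
      much_less G (Theta b) (fun=> 1),
      (much_less G (fun=> 1) (Theta a) /\
       much_less G (Theta a) (fun p => L p.1 ^+ 2 / a p.1 ^+ 2)) &
      (fun p => k p * h p.1) =O_G (fun=> 1 : R)].

End Asymptotics.

Section Imaging.

Variable R : realType.

(* The cross-range plane is [R * R], with the product of two copies of the
   Lebesgue measure. *)
Definition lebesgue2 :
    {measure set (measurableTypeR R * measurableTypeR R) -> \bar R} :=
  ((@lebesgue_measure R) \x (@lebesgue_measure R))%E.

Definition norm2 (x : R * R) : R := Num.sqrt (x.1 ^+ 2 + x.2 ^+ 2).

Definition point3 (x : R * R) (z : R) : 'cV[R]_3 :=
  \col_(i < 3) [:: x.1; x.2; z]`_i.

Definition norm3 (v : 'cV[R]_3) : R := Num.sqrt (\sum_i v i 0 ^+ 2).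

Definition frobenius (m n : nat) (A : 'M[R[i]]_(m, n)) : R :=
  Num.sqrt (\sum_i \sum_j ComplexField.Normc.normc (A i j) ^+ 2).

Definition expi (theta : R) : R[i] := cos theta +i* sin theta.

Definition Cintegral d (T : measurableType d) (mu : {measure set T -> \bar R})
    (D : set T) (f : T -> R[i]) : R[i] :=
  (\int[mu]_(x in D) complex.Re (f x)) +i* (\int[mu]_(x in D) complex.Im (f x)).

Definition mxintegral d (T : measurableType d)
    (mu : {measure set T -> \bar R}) (m n : nat) (D : set T)
    (M : T -> 'M[R[i]]_(m, n)) : 'M[R[i]]_(m, n) :=
  \matrix_(i, j) Cintegral mu D (fun x => M x i j).

Definition green (x y : 'cV[R]_3) (k : R) : R[i] :=
  let r := norm3 (x - y) in expi (k * r) / (4 * pi * r)%:C.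

Definition green_m (s : R) : R[i] := ('i%C * s%:C - 1) / (s ^+ 2)%:C.

Definition dyadic_green (x y : 'cV[R]_3) (k : R) : 'M[R[i]]_3 :=
  let rv := x - y in
  let r := norm3 rv in
  green x y k *:
    ((1 + green_m (k * r))%:M
     - (1 + 3 * green_m (k * r)) *:
         map_mx (real_complex R) ((r ^+ 2)^-1 *: (rv *m rv^T))).

Definition array_disk (a : R) : set (R * R) := [set x | norm2 x <= a].

Definition array_point (x : R * R) : 'cV[R]_3 := point3 x 0.

Definition conj_mx (m n : nat) (A : 'M[R[i]]_(m, n)) : 'M[R[i]]_(m, n) :=
  map_mx (@conjc R) A.

Definition array_response (N : nat) (ys : 'I_N -> 'cV[R]_3)
    (alpha : 'I_N -> 'M[R[i]]_3) (xr xs : R * R) (k : R) : 'M[R[i]]_3 :=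
  \sum_(n < N) dyadic_green (array_point xr) (ys n) k *m alpha n
               *m dyadic_green (ys n) (array_point xs) k.

Definition kirchhoff (a : R) (data : R * R -> R * R -> R -> 'M[R[i]]_3)
    (y : 'cV[R]_3) (k : R) : 'M[R[i]]_3 :=
  mxintegral lebesgue2 (array_disk a) (fun xs =>
    mxintegral lebesgue2 (array_disk a) (fun xr =>
      conj_mx (dyadic_green (array_point xr) y k) *m data xr xs k
      *m conj_mx (dyadic_green (array_point xs) y k))).

Definition Hmx (a : R) (y y' : 'cV[R]_3) (k : R) : 'M[R[i]]_3 :=
  mxintegral lebesgue2 (array_disk a) (fun xr =>
    conj_mx (dyadic_green (array_point xr) y k)
    *m dyadic_green (array_point xr) y' k).

Definition block12 (A : 'M[R[i]]_3) : 'M[R[i]]_2 :=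
  ulsubmx (A : 'M[R[i]]_(2 + 1)).

(* [invmx A] is [A] itself when [A] is singular; the estimate is only
   meaningful where the block of [Hmx] is invertible. *)
Definition alpha_freq (a : R) (data : R * R -> R * R -> R -> 'M[R[i]]_3)
    (y : 'cV[R]_3) (k : R) : 'M[R[i]]_2 :=
  let Hinv := invmx (block12 (Hmx a y y k)) in
  Hinv *m block12 (kirchhoff a data y k) *m Hinv.

Definition alpha_band (c omega0 B a : R)
    (data : R * R -> R * R -> R -> 'M[R[i]]_3) (y : 'cV[R]_3) : 'M[R[i]]_2 :=
  (B^-1)%:C *:
    mxintegral (@lebesgue_measure R) [set omega | `|omega - omega0| < B / 2]
      (fun omega => alpha_freq a data y (omega / c)).

(* c / (B min_(j | P j) d j), and 0 when no index satisfies P *)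
Definition range_term (N : nat) (c B : R) (P : pred 'I_N) (d : 'I_N -> R) : R :=
  if [pick j | P j] is Some j0 then
    c / (B * d [arg min_(j < j0 | P j) d j]%O)
  else 0.

End Imaging.

(* Main.v *)
Require Import Defs.
From HB Require Import structures.
From mathcomp Require Import all_boot all_order all_algebra.
From mathcomp Require Import complex.
From mathcomp Require Import all_classical all_reals all_analysis.
From mathcomp Require Import measurable_realfun.
From mathcomp Require Import ring lra.

Set Implicit Arguments.
Unset Strict Implicit.
Unset Printing Implicit Defensive.

Import Order.TTheory GRing.Theory Num.Theory.
Import numFieldNormedType.Exports.

Local Open Scope classical_set_scope.
Local Open Scope ring_scope.

(* Write P for the projection onto the cross-range plane. In the Fraunhofer
   regime 4 pi L e^(-ikr) G(x, y) tends to P, and, because kh = O(1),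
   k(|x - y_n| - |x - y|) - k(eta_n - eta) tends to 0, uniformly over the array,
   the frequency band and the imaging window. Hence the integrands of H and of
   I_KM are, up to a common scaling and o(1), the constants P and
   sum_n e^(2ik(eta_n - eta)) P alpha_n P, so that
     alpha_(1:2,1:2)(omega) = sum_n e^(2ik(eta_n - eta)) alpha_(n;1:2,1:2) + o(1).
   Averaging over the band keeps the term with eta_n = eta, while the mean of any
   other oscillating factor is at most 2c / (B |eta_n - eta|). *)

(** Two obstacles shape the development. First, every limit has to be uniform in the frequency, in
    the range of the imaging point and in the array points. These variables are therefore made
    components of the index: a limit along [uniformly F D] is an ordinary limit along a filter on
    [T * S]. The geometric estimates are proved for families over an arbitrary index type [Q] with a
    filter, and uniformity results from instantiating the families with coordinates of the index;
    integrating over the array then removes one coordinate. Second, the integrands contain square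
    roots, inverses and inner integrals, and measurability is never established for them. Integrals
    are compared by monotonicity alone, so that integrability is only ever checked for the explicit
    limit: a constant over the array, a finite sum of phases over the band. *)

Local Notation normc := ComplexField.Normc.normc.

(** * Bounds for the complex modulus and the Frobenius norm *)

Section ComplexModulus.
Variable R : realType.
Implicit Types (x y z : R[i]) (r : R).

Lemma normc_ge0 z : 0 <= normc z.
Proof. by case: z => a b; rewrite sqrtr_ge0. Qed.

Lemma normcB_sym x y : normc (x - y) = normc (y - x).
Proof. by rewrite -opprB normcN. Qed.

Lemma normc_sum (I : Type) (s : seq I) (P : pred I) (f : I -> R[i]) :
  normc (\sum_(i <- s | P i) f i) <= \sum_(i <- s | P i) normc (f i).
Proof.
apply: (big_ind2 (fun x r => normc x <= r)) => //.
  by rewrite ComplexField.Normc.normc0.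
by move=> x1 r1 x2 r2 h1 h2; rewrite (le_trans (le_normcD _ _))// lerD.
Qed.

Lemma normc_real r : normc (real_complex R r) = `|r|.
Proof. by rewrite /= expr0n addr0 sqrtr_sqr. Qed.

Lemma normc_conj z : normc (conjc z) = normc z.
Proof. by case: z => a b /=; rewrite sqrrN. Qed.

Lemma normc_expi r : normc (expi r) = 1.
Proof. by rewrite /= cos2Dsin2 sqrtr1. Qed.

Lemma expiD (s t : R) : expi (s + t) = expi s * expi t.
Proof.
rewrite /expi cosD sinD; apply/eqP; rewrite eq_complex /=.
by rewrite eqxx addrC eqxx.
Qed.

Lemma ler_Re_normc z : `|complex.Re z| <= normc z.
Proof. by case: z => a b /=; rewrite -sqrtr_sqr ler_wsqrtr// lerDl sqr_ge0. Qed.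

Lemma ler_Im_normc z : `|complex.Im z| <= normc z.
Proof. by case: z => a b /=; rewrite -sqrtr_sqr ler_wsqrtr// lerDr sqr_ge0. Qed.

Lemma ler_normc_ReIm z : normc z <= `|complex.Re z| + `|complex.Im z|.
Proof.
case: z => a b /=.
rewrite -[leRHS]ger0_norm ?addr_ge0// -sqrtr_sqr ler_wsqrtr//.
by rewrite sqrrD !real_normK ?num_real// addrAC lerDl mulrn_wge0// mulr_ge0.
Qed.

Lemma frobenius_ge0 m n (A : 'M[R[i]]_(m, n)) : 0 <= frobenius A.
Proof. exact: sqrtr_ge0. Qed.

Lemma normc_le_frobenius m n (A : 'M[R[i]]_(m, n)) i j :
  normc (A i j) <= frobenius A.
Proof.
rewrite -[leLHS]ger0_norm ?normc_ge0// -sqrtr_sqr ler_wsqrtr//.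
rewrite (bigD1 i)//= (bigD1 j)//= -addrA lerDl addr_ge0// ?sumr_ge0//.
  by move=> *; exact: sqr_ge0.
by move=> *; rewrite sumr_ge0// => *; exact: sqr_ge0.
Qed.

Lemma frobenius_le_sum m n (A : 'M[R[i]]_(m, n)) :
  frobenius A <= \sum_i \sum_j normc (A i j).
Proof.
have sq_sum (I : finType) (f : I -> R) : (forall i, 0 <= f i) ->
    \sum_i f i ^+ 2 <= (\sum_i f i) ^+ 2.
  move=> f0; pose K (x y : R) := 0 <= y /\ x <= y ^+ 2.
  suff: K (\sum_i f i ^+ 2) (\sum_i f i) by case.
  apply: (big_ind2 K) => //.
  move=> x1 y1 x2 y2 [h1 h2] [h3 h4]; split; first exact: addr_ge0.
  by rewrite (le_trans (lerD h2 h4))//; nra.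
rewrite -[leRHS]ger0_norm; last first.
  by rewrite !sumr_ge0// => i _; rewrite sumr_ge0// => j _; exact: normc_ge0.
rewrite -sqrtr_sqr ler_wsqrtr//.
apply: le_trans (sq_sum _ _ _); last first.
  by move=> i; rewrite sumr_ge0// => j _; exact: normc_ge0.
by apply: ler_sum => i _; apply: sq_sum => j; exact: normc_ge0.
Qed.

End ComplexModulus.

(** * Integrals of functions uniformly close to an integrable one *)

Section IntegralPerturbation.
Context d (T : measurableType d) (R : realType).
Variable mu : {measure set T -> \bar R}.

Lemma integrable_cst_finite (D : set T) (r : R) :
  measurable D -> (mu D < +oo)%E -> mu.-integrable D (EFin \o cst r).
Proof.
move=> mD muD; apply: measurable_bounded_integrable => //.
by exists `|r|; split; [exact: num_real | move=> M rM x _; exact: ltW].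
Qed.

(* The integral is a difference of suprema over simple functions, so it is
   monotone even on functions that are not measurable. *)
Lemma le_integral_nonmeasurable (D : set T) (f g : T -> \bar R) :
  (forall x, D x -> f x <= g x)%E ->
  (\int[mu]_(x in D) f x <= \int[mu]_(x in D) g x)%E.
Proof.
move=> fg; have fgD x : ((f \_ D) x <= (g \_ D) x)%E.
  by rewrite /patch; case: ifPn => // /set_mem/fg.
rewrite /integral; apply: leeB; apply: ge_ereal_sup => _ [h hf <-];
    apply: ereal_sup_ubound; exists h => // x; apply: le_trans (hf x) _.
- by rewrite !funeposE ge_max !le_max fgD lexx orbT.
- by rewrite !funenegE ge_max !le_max leeN2 fgD lexx orbT.
Qed.

(** The function [f] is squeezed between [g - eps] and [g + eps], whose integrals are finite;
    monotonicity gives both the finiteness of the integral of [f] and the estimate. This form serves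
    integrands of unestablished measurability. *)
Lemma Rintegral_dist (D : set T) (f g : T -> R) (eps : R) :
  measurable D -> (mu D < +oo)%E -> mu.-integrable D (EFin \o g) ->
  (forall x, D x -> `|f x - g x| <= eps) ->
  `|\int[mu]_(x in D) f x - \int[mu]_(x in D) g x| <= eps * fine (mu D).
Proof.
move=> mD muD ig fg.
have icst r : mu.-integrable D (EFin \o cst r) by
    exact: integrable_cst_finite.
have intg r : (\int[mu]_(x in D) (g x + r)%:E =
    (\int[mu]_(x in D) g x + r * fine (mu D))%R%:E)%E.
  rewrite -[LHS]fineK.
    by rewrite -Rintegral_cst// -RintegralD//; exact: icst.
  rewrite -[X in X \is a _]/(\int[mu]_(x in D) ((EFin \o g) \+ (EFin \o cst r)) x)%E.
  by apply: integrable_fin_num => //; exact: integrableD.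
have lef : (\int[mu]_(x in D) (f x)%:E <=
    (\int[mu]_(x in D) g x + eps * fine (mu D))%R%:E)%E.
  rewrite -intg; apply: le_integral_nonmeasurable => x Dx; rewrite lee_fin.
  by rewrite -lerBlDl (le_trans (ler_norm _))// fg.
have gef : ((\int[mu]_(x in D) g x - eps * fine (mu D))%R%:E <=
    \int[mu]_(x in D) (f x)%:E)%E.
  rewrite -mulNr -intg; apply: le_integral_nonmeasurable => x Dx; rewrite lee_fin.
  by rewrite lerBlDr -lerBlDl (le_trans (ler_norm _))// distrC fg.
(* [Rintegral] applies [fine], which sends infinities to 0, so finiteness must be known before the
   two bounds can be transferred. *)
have ff : (\int[mu]_(x in D) (f x)%:E \is a fin_num)%E.
  by rewrite fin_real// (lt_le_trans (ltNyr _) gef) (le_lt_trans lef (ltry _)).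
rewrite ler_distl -!lee_fin /Rintegral (fineK ff).
by rewrite gef lef.
Qed.

(** The factor 2 comes from bounding the real and imaginary parts separately. *)
Lemma Cintegral_dist (D : set T) (f g : T -> R[i]) (eps : R) :
  measurable D -> (mu D < +oo)%E ->
  mu.-integrable D (EFin \o (fun x => complex.Re (g x))) ->
  mu.-integrable D (EFin \o (fun x => complex.Im (g x))) ->
  (forall x, D x -> normc (f x - g x) <= eps) ->
  normc (Cintegral mu D f - Cintegral mu D g) <= 2 * eps * fine (mu D).
Proof.
move=> mD muD reg img fg.
apply: le_trans (ler_normc_ReIm _) _; rewrite -mulrA mulr_natl mulr2n.
apply: lerD => /=; apply: Rintegral_dist => // x Dx; apply: le_trans (fg x Dx).
  by apply: le_trans (ler_Re_normc _); case: (f x) => ? ?; case: (g x).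
by apply: le_trans (ler_Im_normc _); case: (f x) => ? ?; case: (g x).
Qed.

(** The comparison function is the constant [v / w], whose integral times [w / fine (mu D)] is
    exactly [v]. *)
Lemma Cintegral_near_const (D : set T) (f : T -> R[i]) (v : R[i]) (w eps : R) :
  measurable D -> (0 < mu D)%E -> (mu D < +oo)%E -> 0 < w ->
  (forall x, D x -> normc (real_complex R w * f x - v) <= eps) ->
  normc (real_complex R (w / fine (mu D)) * Cintegral mu D f - v) <= 2 * eps.
Proof.
move=> mD mu0 muD w0 fv.
have m0 : 0 < fine (mu D) by rewrite fine_gt0// mu0.
have icst r : mu.-integrable D (EFin \o cst r) by
    exact: integrable_cst_finite.
have wc : real_complex R w != 0 by rewrite fmorph_eq0 gt_eqF.
pose g := cst (v / real_complex R w) : T -> R[i].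
have /Cintegral_dist : forall x, D x -> normc (f x - g x) <= eps / w.
  move=> x Dx; rewrite ler_pdivlMr// mulrC -[X in X * _]gtr0_norm// -normc_real.
  by rewrite -ComplexField.Normc.normcM mulrBr /g /cst mulrCA divff// mulr1 fv.
move=> /(_ mD muD (icst _) (icst _)) fg.
have -> : v = real_complex R (w / fine (mu D)) * Cintegral mu D g.
  rewrite /Cintegral /g !Rintegral_cst//.
  have -> (z : R[i]) (r : R) : Complex (complex.Re z * r) (complex.Im z * r) = z * real_complex R r.
    by case: z => a b; rewrite /real_complex_def /=; simpc.
  have fieldE (W M V : R[i]) : W != 0 -> M != 0 -> V = W / M * (V / W * M).
    by move=> W0 M0; field; rewrite W0 M0.
  by rewrite fmorph_div; apply: fieldE; rewrite // fmorph_eq0 gt_eqF.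
rewrite -mulrBr ComplexField.Normc.normcM normc_real gtr0_norm ?divr_gt0//.
apply: le_trans (ler_wpM2l _ fg) _; first by rewrite divr_ge0 ?ltW.
rewrite le_eqVlt; apply/orP; left; apply/eqP; field.
by rewrite !gt_eqF.
Qed.

End IntegralPerturbation.

(** * Asymptotic equality along a filter and its stability under algebra *)

Section Asymptotically.
Variables (R : realType) (Q : Type) (G : set_system Q).
Context {FG : Filter G}.
Implicit Types (f g : Q -> R[i]) (u v : Q -> R).

(* Boundedness of [g] is included so that the relation is stable under
   products. *)
Definition asym f g : Prop :=
  (exists M : R, \forall q \near G, normc (g q) <= M) /\
  (forall eps : R, 0 < eps -> \forall q \near G, normc (f q - g q) <= eps).

Lemma asym_bounded f g : asym f g ->
  exists2 M : R, 0 < M & \forall q \near G, normc (f q) <= M /\ normc (g q) <= M.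
Proof.
move=> [[M gM] fg]; exists (`|M| + 1); first by rewrite ltr_pwDr.
near=> q; have gq : normc (g q) <= M by near: q.
have dq : normc (f q - g q) <= 1 by near: q; exact: fg.
have gq' : normc (g q) <= `|M| by rewrite (le_trans gq)// ler_norm.
split; last by rewrite (le_trans gq')// lerDl.
by rewrite -(subrK (g q) (f q)) (le_trans (le_normcD _ _))// addrC lerD.
Unshelve. all: by end_near. Qed.

Lemma asym_refl f (M : R) : (\forall q \near G, normc (f q) <= M) -> asym f f.
Proof.
move=> fM; split; first by exists M.
move=> e e0; near=> q.
by rewrite subrr ComplexField.Normc.normc0 ltW.
Unshelve. all: by end_near. Qed.

Lemma asym_cst (c : R[i]) : asym (fun=> c) (fun=> c).
Proof. by apply: (@asym_refl _ (normc c)); near=> q. Unshelve. all: by end_near. Qed.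

Lemma asym_near f f' g : (\forall q \near G, f q = f' q) -> asym f g -> asym f' g.
Proof.
move=> ff' [bg fg]; split=> // e e0; near=> q.
have <- : f q = f' q by near: q.
by near: q; exact: fg.
Unshelve. all: by end_near. Qed.

Lemma asymD f1 f2 g1 g2 : asym f1 g1 -> asym f2 g2 ->
  asym (fun q => f1 q + f2 q) (fun q => g1 q + g2 q).
Proof.
move=> [[M1 h1] e1] [[M2 h2] e2]; split.
  exists (M1 + M2); near=> q; rewrite (le_trans (le_normcD _ _))// lerD//; by near: q.
move=> e e0; have e20 : 0 < e / 2 by rewrite divr_gt0.
near=> q; rewrite opprD addrACA (le_trans (le_normcD _ _))// [leRHS]splitr lerD//.
  by near: q; exact: e1.
by near: q; exact: e2.
Unshelve. all: by end_near. Qed.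

Lemma asymM f1 f2 g1 g2 : asym f1 g1 -> asym f2 g2 ->
  asym (fun q => f1 q * f2 q) (fun q => g1 q * g2 q).
Proof.
move=> a1 a2; have [M1 M10 h1] := asym_bounded a1.
have [M2 M20 h2] := asym_bounded a2; case: a1 a2 => [_ e1] [_ e2]; split.
  exists (M1 * M2); near=> q; rewrite ComplexField.Normc.normcM.
  have [_ q1] : normc (f1 q) <= M1 /\ normc (g1 q) <= M1 by near: q.
  have [_ q2] : normc (f2 q) <= M2 /\ normc (g2 q) <= M2 by near: q.
  by rewrite ler_pM ?normc_ge0.
move=> e e0; near=> q.
have [q1 _] : normc (f1 q) <= M1 /\ normc (g1 q) <= M1 by near: q.
have [_ q2] : normc (f2 q) <= M2 /\ normc (g2 q) <= M2 by near: q.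
have -> : f1 q * f2 q - g1 q * g2 q =
    f1 q * (f2 q - g2 q) + (f1 q - g1 q) * g2 q by ring.
rewrite (le_trans (le_normcD _ _))// [leRHS]splitr.
rewrite !ComplexField.Normc.normcM lerD//.
  have d2 : normc (f2 q - g2 q) <= e / 2 / M1.
    by near: q; apply: e2; rewrite !divr_gt0.
  apply: le_trans (ler_pM _ _ q1 d2) _; rewrite ?normc_ge0//.
  by rewrite mulrC divfK ?gt_eqF.
have d1 : normc (f1 q - g1 q) <= e / 2 / M2.
  by near: q; apply: e1; rewrite !divr_gt0.
apply: le_trans (ler_pM _ _ d1 q2) _; rewrite ?normc_ge0//.
by rewrite divfK ?gt_eqF.
Unshelve. all: by end_near. Qed.

Lemma asym_sum (I : finType) (P : pred I) (f g : I -> Q -> R[i]) :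
  (forall i, asym (f i) (g i)) ->
  asym (fun q => \sum_(i | P i) f i q) (fun q => \sum_(i | P i) g i q).
Proof.
move=> fg.
elim: (index_enum I) => [|i s IH].
  by under eq_fun do rewrite big_nil; under [X in asym _ X]eq_fun do rewrite big_nil;
    exact: asym_cst.
under eq_fun do rewrite big_cons; under [X in asym _ X]eq_fun do rewrite big_cons.
by case: (P i) => //; apply: asymD.
Qed.

Lemma asym_prod (I : finType) (f g : I -> Q -> R[i]) :
  (forall i, asym (f i) (g i)) ->
  asym (fun q => \prod_i f i q) (fun q => \prod_i g i q).
Proof.
move=> fg; elim: (index_enum I) => [|i s IH].
  by under eq_fun do rewrite big_nil; under [X in asym _ X]eq_fun do rewrite big_nil;
    exact: asym_cst.
under eq_fun do rewrite big_cons; under [X in asym _ X]eq_fun do rewrite big_cons.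
by apply: asymM.
Qed.

Lemma asym_conj f g : asym f g -> asym (fun q => conjc (f q)) (fun q => conjc (g q)).
Proof.
move=> [[M h] e]; split.
  by exists M; near=> q; rewrite normc_conj; near: q.
move=> e1 e10; near=> q; rewrite -rmorphB normc_conj; near: q; exact: e.
Unshelve. all: by end_near. Qed.

Lemma asym_complex u v (a b : R) : u @ G --> a -> v @ G --> b ->
  asym (fun q => Complex (u q) (v q)) (fun=> Complex a b).
Proof.
move=> ua vb; split; first by exists (normc (Complex a b)); near=> q.
move=> e e0; have e20 : 0 < e / 2 by rewrite divr_gt0.
near=> q; apply: le_trans (ler_normc_ReIm _) _; rewrite [leRHS]splitr /= lerD// distrC.
  by near: q; move/cvgrPdist_le: ua; apply.
by near: q; move/cvgrPdist_le: vb; apply.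
Unshelve. all: by end_near. Qed.

Lemma asym_real u (a : R) : u @ G --> a ->
  asym (fun q => real_complex R (u q)) (fun=> real_complex R a).
Proof. by move=> ua; apply: (@asym_complex u (fun=> 0)) => //; exact: cvg_cst. Qed.

(** The phases [u] and [v] may each be unbounded: only [expi (u - v)] is compared with 1, by
    continuity at 0, and the factor [expi v] of modulus 1 is multiplied back. *)
Lemma asym_expi u v : (fun q => u q - v q) @ G --> 0 ->
  asym (fun q => expi (u q)) (fun q => expi (v q)).
Proof.
move=> uv0.
have e1 : asym (fun q => expi (u q - v q)) (fun=> 1).
  rewrite (_ : (fun=> 1) = fun=> expi 0 :> R[i]); last first.
    by apply/funext => q; rewrite /expi cos0 sin0.
  apply: (asym_complex (u := cos \o (fun q => u q - v q))
                       (v := sin \o (fun q => u q - v q))).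
    by apply: continuous_cvg => //; exact: continuous_cos.
  by apply: continuous_cvg => //; exact: continuous_sin.
have e2 : asym (fun q => expi (v q)) (fun q => expi (v q)).
  by apply: (@asym_refl _ 1); near=> q; rewrite normc_expi.
have := asymM e1 e2; under [X in asym _ X]eq_fun do rewrite mul1r.
by congr asym; apply/funext => q; rewrite -expiD subrK.
Unshelve. all: by end_near. Qed.

Lemma asym1_unit f : asym f (fun=> 1) -> \forall q \near G, f q != 0.
Proof.
move=> [_ /(_ (1 / 2))f1]; have h : (0 : R) < 1 / 2 by [].
near=> q; apply/negP => /eqP fq0.
have : normc (f q - 1) <= 1 / 2 by near: q; exact: f1.
by rewrite fq0 sub0r normcN ComplexField.Normc.normc1; lra.
Unshelve. all: by end_near. Qed.

(** Once [f] is within 1/2 of 1 its modulus is at least 1/2, and [1 / f - 1 = (1 - f) / f] is at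
    most twice the distance from [f] to 1. *)
Lemma asym1_inv f : asym f (fun=> 1) -> asym (fun q => (f q)^-1) (fun=> 1).
Proof.
move=> f1; split; first by exists (normc (1 : R[i])); near=> q.
move=> e e0; near=> q.
have fq0 : f q != 0 by near: q; exact: asym1_unit.
have d1 : normc (f q - 1) <= 1 / 2 by near: q; apply: f1.2.
have d2 : normc (f q - 1) <= e / 2 by near: q; apply: f1.2; rewrite divr_gt0.
have fq : 1 / 2 <= normc (f q).
  have := le_normcD (f q) (1 - f q); rewrite subrKC ComplexField.Normc.normc1.
  by rewrite normcB_sym; lra.
have -> : (f q)^-1 - 1 = (1 - f q) * (f q)^-1 by rewrite mulrBl mul1r divff.
rewrite ComplexField.Normc.normcM ComplexField.Normc.normcV normcB_sym.
by rewrite ler_pdivrMr; [nra | lra].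
Unshelve. all: by end_near. Qed.

Definition mxasym m n (A B : Q -> 'M[R[i]]_(m, n)) : Prop :=
  forall i j, asym (fun q => A q i j) (fun q => B q i j).

Lemma mxasym_near m n (A A' B : Q -> 'M[R[i]]_(m, n)) :
  (\forall q \near G, A q = A' q) -> mxasym A B -> mxasym A' B.
Proof.
move=> AA' AB i j; apply: asym_near (AB i j); near=> q.
by congr fun_of_matrix; near: q.
Unshelve. all: by end_near. Qed.

Lemma mxasymZ m n (f g : Q -> R[i]) (A B : Q -> 'M[R[i]]_(m, n)) :
  asym f g -> mxasym A B -> mxasym (fun q => f q *: A q) (fun q => g q *: B q).
Proof.
move=> h1 h2 i j; under eq_fun do rewrite mxE.
by under [X in asym _ X]eq_fun do rewrite mxE; exact: asymM.
Qed.

Lemma mxasymM m n p (A1 B1 : Q -> 'M[R[i]]_(m, n)) (A2 B2 : Q -> 'M[R[i]]_(n, p)) :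
  mxasym A1 B1 -> mxasym A2 B2 ->
  mxasym (fun q => A1 q *m A2 q) (fun q => B1 q *m B2 q).
Proof.
move=> h1 h2 i j; under eq_fun do rewrite mxE.
by under [X in asym _ X]eq_fun do rewrite mxE; apply: asym_sum => k; exact: asymM.
Qed.

Lemma mxasym_sum (I : finType) m n (A B : I -> Q -> 'M[R[i]]_(m, n)) :
  (forall k, mxasym (A k) (B k)) ->
  mxasym (fun q => \sum_k A k q) (fun q => \sum_k B k q).
Proof.
move=> h i j; under eq_fun do rewrite summxE.
by under [X in asym _ X]eq_fun do rewrite summxE; apply: asym_sum => k; exact: h.
Qed.

Lemma mxasym_conj m n (A B : Q -> 'M[R[i]]_(m, n)) : mxasym A B ->
  mxasym (fun q => conj_mx (A q)) (fun q => conj_mx (B q)).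
Proof.
move=> h i j; under eq_fun do rewrite mxE.
by under [X in asym _ X]eq_fun do rewrite mxE; exact: asym_conj.
Qed.

Lemma mxasym_block12 (A B : Q -> 'M[R[i]]_3) : mxasym A B ->
  mxasym (fun q => block12 (A q)) (fun q => block12 (B q)).
Proof.
move=> h i j; under eq_fun do rewrite mxE mxE.
by under [X in asym _ X]eq_fun do rewrite mxE mxE; exact: h.
Qed.

Lemma asym_det n (A B : Q -> 'M[R[i]]_n) : mxasym A B ->
  asym (fun q => \det (A q)) (fun q => \det (B q)).
Proof.
move=> h; apply: asym_sum => s; apply: asymM; first exact: asym_cst.
by apply: asym_prod => i; exact: h.
Qed.

(** Cramer's rule: the determinant and the adjugate are polynomial in the entries, hence converge.
    As the determinant tends to 1, [A q] is eventually invertible and [invmx] is a true inverse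
    rather than its default value. *)
Lemma mxasym_invmx n (A : Q -> 'M[R[i]]_n) : mxasym A (fun=> 1%:M) ->
  mxasym (fun q => invmx (A q)) (fun=> 1%:M).
Proof.
move=> A1; have d1 : asym (fun q => \det (A q)) (fun=> 1).
  by have := asym_det A1; under [X in asym _ X]eq_fun do rewrite det1.
have adj1 : mxasym (fun q => \adj (A q)) (fun=> \adj 1%:M).
  move=> i j; under eq_fun do rewrite mxE; rewrite mxE.
  apply: asymM; first exact: asym_cst.
  apply: asym_det => k l; under eq_fun do rewrite mxE mxE.
  by under [X in asym _ X]eq_fun do rewrite mxE mxE; exact: A1.
have := mxasymZ (asym1_inv d1) adj1.
under [X in mxasym _ X]eq_fun do rewrite scale1r.
have -> : \adj (1%:M : 'M[R[i]]_n) = 1%:M.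
  by have := mul_adj_mx (1%:M : 'M[R[i]]_n); rewrite det1 mulmx1.
apply: mxasym_near; near=> q.
have dq : \det (A q) != 0 by near: q; exact: asym1_unit.
by rewrite /invmx unitmxE unitfE dq.
Unshelve. all: by end_near. Qed.

End Asymptotically.

(** * Far-field limit of the dyadic Green function *)

Section GreenAsymptotics.
Variables (R : realType) (Q : Type) (G : set_system Q).
Context {FG : Filter G}.

Lemma cvg0_le (u w : Q -> R) :
  (\forall q \near G, `|u q| <= w q) -> w @ G --> (0 : R) -> u @ G --> (0 : R).
Proof.
move=> uw /cvgr0Pnorm_le w0; apply/cvgr0Pnorm_le => e e0; near=> q.
have h1 : `|u q| <= w q by near: q.
have h2 : `|w q| <= e by near: q; exact: w0.
by rewrite (le_trans h1)// (le_trans (ler_norm _)).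
Unshelve. all: by end_near. Qed.

Lemma cvg_ext (u w : Q -> R) (l : R) : u =1 w -> u @ G --> l -> w @ G --> l.
Proof. by move=> /funext ->. Qed.

(** This is the projection P, that is [I - e_3 e_3^T]: the bracket of the Green dyadic when [m]
    vanishes and the displacement points along the range axis. *)
Definition transverse : 'M[R[i]]_3 := diag_mx (\row_(j < 3) ((j < 2)%N)%:R).

(** Both components are powers of [1 / s], which makes the decay for large [s] visible. With the
    convention [0^-1 = 0] the formula also holds at [s = 0]. *)
Lemma green_mE (s : R) : green_m s = Complex (- s^-1 ^+ 2) s^-1.
Proof.
rewrite /green_m; have [->|s0] := eqVneq s 0.
  by rewrite !expr2 invr0 !mulr0 invr0 mulr0 oppr0.
rewrite -fmorphV/=; apply/eqP; rewrite eq_complex /=; apply/andP; split; apply/eqP.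
  by field.
by field.
Qed.

(* The limit is a projection because [(X - Y) / |X - Y|] tends to [s e_3]. *)
Lemma dyadic_green_asym (X Y : Q -> 'cV[R]_3) (k L : Q -> R) (s : R) :
  s ^+ 2 = 1 -> (forall q, 0 < L q) ->
  (fun q => (k q * L q)^-1) @ G --> (0 : R) ->
  (forall i : 'I_3, (fun q => (X q - Y q) i 0 / L q) @ G -->
     (if (i < 2)%N then 0 else s : R)) ->
  (fun q => norm3 (X q - Y q) / L q) @ G --> (1 : R) /\
  mxasym G (fun q => (real_complex R (4 * pi * L q)
                      * expi (- (k q * norm3 (X q - Y q))))
                     *: dyadic_green (X q) (Y q) (k q))
    (fun=> transverse).
Proof.
move=> s21 L0 kL vL.
pose v q i := (X q - Y q) i 0 / L q.
pose l (i : 'I_3) : R := if (i < 2)%N then 0 else s.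
pose rho q := norm3 (X q - Y q) / L q.
(* Moving [L] under the square root reduces the limit of [rho] to that of the scaled components,
   namely [sqrt (s ^ 2) = 1]. *)
have rhoE q : rho q = Num.sqrt (v q 0 * v q 0 + v q 1 * v q 1 + v q 2%:R * v q 2%:R).
  rewrite /rho /norm3 -{1}[L q]gtr0_norm// -sqrtr_sqr -sqrtrV ?sqr_ge0// -sqrtrM.
    rewrite !big_ord_recl big_ord0 /v; congr Num.sqrt.
    have -> : lift ord0 ord0 = 1 :> 'I_3 by exact: val_inj.
    have -> : lift ord0 (lift ord0 ord0) = 2%:R :> 'I_3 by exact: val_inj.
    by have := L0 q; move=> /gt_eqF/negbT; move: (X q - Y q) => w Lq; field.
  by apply: sumr_ge0 => i _; exact: sqr_ge0.
have rho1 : rho @ G --> (1 : R).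
  have : (fun q => v q 0 * v q 0 + v q 1 * v q 1 + v q 2%:R * v q 2%:R) @ G -->
      l 0 * l 0 + l 1 * l 1 + l 2%:R * l 2%:R.
    by apply: cvgD; [apply: cvgD|]; apply: cvgM; exact: vL.
  rewrite /l /= !mul0r !add0r -expr2 s21 => h.
  rewrite (funext rhoE) -sqrtr1.
  by apply: continuous_cvg => //; exact: sqrt_continuous.
split => //.
have rhoV : (fun q => (rho q)^-1) @ G --> (1 : R).
  have := @cvgV _ _ _ FG _ _ (oner_neq0 R) rho1; rewrite invr1; apply.
(* Here [k r = (k L) rho] with [(k L)^-1] tending to 0, so [m (k r)] will vanish in the limit. *)
have krV : (fun q => (k q * norm3 (X q - Y q))^-1) @ G --> (0 : R).
  have := @cvgM _ _ _ FG _ _ _ _ kL rhoV; rewrite mul0r => h.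
  refine (cvg_ext _ h) => q; rewrite /= /rho.
  rewrite !invfM !invrK -!mulrA; congr (_ * _).
  by rewrite mulrCA mulVf ?mulr1 ?gt_eqF.
have m0 : asym G (fun q => green_m (k q * norm3 (X q - Y q))) (fun=> 0).
  under eq_fun do rewrite green_mE.
  rewrite (_ : 0 = Complex (- (0 * 0)) 0 :> R[i]); last by rewrite mul0r oppr0.
  apply: asym_complex => //; apply: cvgN.
  by under eq_fun do rewrite expr2; exact: cvgM.
have vv i j : asym G
    (fun q => map_mx (real_complex R)
       ((norm3 (X q - Y q) ^+ 2)^-1 *: ((X q - Y q) *m (X q - Y q)^T)) i j)
    (fun=> real_complex R (l i * l j)).
  under eq_fun do rewrite !mxE big_ord1 [(_^T) _ _]mxE.
  apply: asym_real; have rhoVV := @cvgM _ _ _ FG _ _ _ _ rhoV rhoV.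
  have vLL := @cvgM _ _ _ FG _ _ _ _ (vL i) (vL j).
  have := @cvgM _ _ _ FG _ _ _ _ rhoVV vLL.
  rewrite !mul1r => h; refine (cvg_ext _ h) => q; rewrite /= /rho.
  rewrite !invfM !invrK.
  have := L0 q; move=> /gt_eqF/negbT Lq0.
  move: (norm3 _)^-1 => r; move: (X q - Y q) => w.
  by field.
move=> i j.
(* The opposite phase cancels the exponential and [4 pi L / (4 pi r)] is [1 / rho], so only
   convergent factors remain. *)
have gE : (fun q => ((real_complex R (4 * pi * L q) *
      expi (- (k q * norm3 (X q - Y q)))) *: dyadic_green (X q) (Y q) (k q)) i j)
  = fun q => real_complex R (rho q)^-1 *
      ((1 + green_m (k q * norm3 (X q - Y q))) * (i == j)%:R
       + (-1) * ((1 + 3 * green_m (k q * norm3 (X q - Y q))) *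
         map_mx (real_complex R)
       ((norm3 (X q - Y q) ^+ 2)^-1 *: ((X q - Y q) *m (X q - Y q)^T)) i j)).
  apply/funext => q; rewrite /dyadic_green /green.
  rewrite scalerA [LHS]mxE; congr (_ * _); last first.
    rewrite [LHS]mxE; congr (_ + _); first by rewrite mxE mulr_natr.
    by rewrite mulN1r [LHS]mxE; congr (- _); rewrite [LHS]mxE.
  rewrite mulrA -(mulrA (real_complex R _)) -expiD addNr.
  rewrite /expi cos0 sin0 mulr1 /rho -fmorph_div; congr (real_complex R _).
  rewrite !invfM invrK [_ / norm3 _]mulrC.
  have : pi != 0 :> R by rewrite gt_eqF// pi_gt0.
  by move: (norm3 _)^-1 pi => z p p0; field.
rewrite gE.
have -> : (fun _ : Q => transverse i j) = fun q => real_complex R 1 *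
   ((1 + 0) * (i == j)%:R + (-1) * ((1 + 3 * 0) * real_complex R (l i * l j))).
  apply/funext => q; rewrite /transverse !mxE mulr0 !addr0 !mul1r mulN1r /l.
  (* Off the diagonal at least one index is a cross-range one, so [l i * l j = 0]; on the diagonal
     the range entry is [1 - s ^ 2 = 0]. *)
  have [ij|ij] := eqVneq i j; last first.
    rewrite mulr0n sub0r.
    case: ifPn => i2; first by rewrite mul0r oppr0.
    case: ifPn => j2; first by rewrite mulr0 oppr0.
    case/eqP: ij; apply/val_inj => /=.
    have ge2 (n : 'I_3) : ~~ (n < 2)%N -> n = 2%N :> nat.
      by case: n => [[|[|[|]]]].
    by rewrite (ge2 _ i2) (ge2 _ j2).
  rewrite -ij mulr1n; case: ifPn => i2; first by rewrite mul0r oppr0 addr0.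
  by rewrite -expr2 s21 subrr.
apply: asymM; first exact: asym_real.
apply: asymD.
  apply: asymM; last exact: asym_cst.
  by apply: asymD => //; exact: asym_cst.
apply: asymM; first exact: asym_cst.
apply: asymM; last exact: vv.
apply: asymD; first exact: asym_cst.
by apply: asymM => //; exact: asym_cst.
Unshelve. all: by end_near. Qed.

End GreenAsymptotics.

(** * Displacements and path lengths between the array and the imaging line *)

Section Geometry.
Variables (R : realType) (Q : Type) (G : set_system Q).
Context {FG : Filter G}.
Variables (k L a b h : Q -> R) (ystar : Q -> R * R) (Kb : R).
Hypothesis L_gt0 : forall q, 0 < L q.
Hypothesis aL0 : (fun q => a q / L q) @ G --> (0 : R).
Hypothesis bL0 : (fun q => b q / L q) @ G --> (0 : R).
Hypothesis hL0 : (fun q => h q / L q) @ G --> (0 : R).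
Hypothesis kL0 : (fun q => (k q * L q)^-1) @ G --> (0 : R).
Hypothesis ystar_le : \forall q \near G, norm2 (ystar q) <= Kb * b q.

Let r (x : Q -> R * R) (e : Q -> R) (q : Q) : R :=
  norm3 (array_point (x q) - point3 (ystar q) (L q + e q)).

Lemma norm2_ge_fst (x : R * R) : `|x.1| <= norm2 x.
Proof. by rewrite -sqrtr_sqr ler_wsqrtr// lerDl sqr_ge0. Qed.

Lemma norm2_ge_snd (x : R * R) : `|x.2| <= norm2 x.
Proof. by rewrite -sqrtr_sqr ler_wsqrtr// lerDr sqr_ge0. Qed.

Lemma norm3B m (v w : 'cV[R]_3) : m = norm3 (v - w) -> norm3 (w - v) = m.
Proof.
move=> ->; congr Num.sqrt; apply: eq_bigr => i _.
by rewrite -opprB mxE sqrrN.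
Qed.

Let cst_cvg (c : R) : (fun _ : Q => c) @ G --> c.
Proof. exact: cvg_cst. Qed.

Lemma cvg0_scale (c : R) (u : Q -> R) :
  u @ G --> (0 : R) -> (fun q => c * u q) @ G --> (0 : R).
Proof.
move=> u0; have := @cvgM _ _ _ FG (fun=> c) u c 0 (@cst_cvg c) u0.
by rewrite mulr0; apply.
Qed.

Lemma eta_over_L (K : R) (e : Q -> R) : (\forall q \near G, `|e q| <= K * h q) ->
  (fun q => e q / L q) @ G --> (0 : R).
Proof.
move=> eh; apply: (@cvg0_le _ _ _ _ _ (fun q => K * (h q / L q))); last exact: cvg0_scale.
near=> q; rewrite normrM normfV (gtr0_norm (L_gt0 q)) mulrA.
by rewrite ler_pM2r ?invr_gt0//; near: q.
Unshelve. all: by end_near. Qed.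

(** Divided by [L], the cross-range components are at most [(a + Kb b) / L], and the range component
    is [-1 - e / L] because the array lies at range 0. *)
Lemma displacement_cvg (K : R) (x : Q -> R * R) (e : Q -> R) :
  (\forall q \near G, norm2 (x q) <= a q) ->
  (\forall q \near G, `|e q| <= K * h q) ->
  forall i : 'I_3,
  (fun q => (array_point (x q) - point3 (ystar q) (L q + e q)) i 0 / L q) @ G -->
    (if (i < 2)%N then 0 else -1 : R).
Proof.
move=> xa eh.
have cross (p : R * R -> R) : (forall z, `|p z| <= norm2 z) ->
    (fun q => (p (x q) - p (ystar q)) / L q) @ G --> (0 : R).
  move=> pn; apply: (@cvg0_le _ _ _ _ _ (fun q => a q / L q + Kb * (b q / L q))).
    near=> q; rewrite normrM normfV (gtr0_norm (L_gt0 q)) mulrA -mulrDl.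
    rewrite ler_pM2r ?invr_gt0// (le_trans (ler_normB _ _))// lerD//.
      by rewrite (le_trans (pn _))//; near: q.
    by rewrite (le_trans (pn _))//; near: q.
  have := @cvgD _ _ _ _ FG _ _ _ _ aL0 (cvg0_scale Kb bL0).
  by rewrite addr0.
case=> [[|[|[|//]]] i3] /=.
- refine (cvg_ext _ (cross fst norm2_ge_fst)) => q.
  by rewrite !mxE.
- refine (cvg_ext _ (cross snd norm2_ge_snd)) => q.
  by rewrite !mxE.
- have := @cvgB _ _ _ _ FG (fun=> -1 : R) _ _ _ (@cst_cvg (-1 : R)) (eta_over_L eh).
  rewrite subr0 => lim; refine (cvg_ext _ lim) => q /=.
  have Lq : L q != 0 by rewrite gt_eqF.
  by rewrite !mxE -[LHS]/(-1 - e q / L q) /=; field.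
Unshelve. all: by end_near. Qed.

(** Needed for the source leg, where the Green dyadic takes the scatterer as its first argument. *)
Lemma displacement_opp_cvg (K : R) (x : Q -> R * R) (e : Q -> R) :
  (\forall q \near G, norm2 (x q) <= a q) ->
  (\forall q \near G, `|e q| <= K * h q) ->
  forall i : 'I_3,
  (fun q => (point3 (ystar q) (L q + e q) - array_point (x q)) i 0 / L q) @ G -->
    (if (i < 2)%N then 0 else 1 : R).
Proof.
move=> xa eh i; have := @cvgN _ _ _ _ FG _ _ (displacement_cvg xa eh (i := i)).
have -> : - (if (i < 2)%N then 0 else -1 : R) = if (i < 2)%N then 0 else 1.
  by case: ifP; rewrite ?oppr0 ?opprK.
move=> lim; refine (cvg_ext _ lim) => q /=.
by rewrite -opprB mxE mulNr.
Qed.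

(** Both endpoints have cross-range position [ystar], so the transverse terms cancel in
    [r'^2 - r^2 = (e' - e) (2 L + e + e')]. Dividing by [r + r'], which is asymptotic to [2 L],
    leaves as error [k (e' - e)] times a factor tending to 0, and [k (e' - e)] is bounded because
    [k h] is. *)
Lemma phase_cvg (K K' M : R) (x : Q -> R * R) (e e' : Q -> R) :
  (\forall q \near G, norm2 (x q) <= a q) ->
  (\forall q \near G, `|e q| <= K * h q) ->
  (\forall q \near G, `|e' q| <= K' * h q) ->
  (\forall q \near G, `|k q * h q| <= M) ->
  (fun q => k q * (r x e' q - r x e q) - k q * (e' q - e q)) @ G --> (0 : R).
Proof.
move=> xa eh eh' khM.
have sqN1 : (-1 : R) ^+ 2 = 1 by rewrite sqrrN expr1n.
have [rho1 _] := dyadic_green_asym sqN1 L_gt0 kL0 (displacement_cvg xa eh).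
have [rho1' _] := dyadic_green_asym sqN1 L_gt0 kL0 (displacement_cvg xa eh').
pose rho q := r x e q / L q; pose rho' q := r x e' q / L q.
(* The relative error made when [r' - r] is replaced by [e' - e], expressed in lengths scaled by
   [L]. *)
pose brk q := (2 + e q / L q + e' q / L q) / (rho q + rho' q) - 1.
have brk0 : brk @ G --> (0 : R).
  have num := @cvgD _ _ _ _ FG _ _ _ _ (@cvgD _ _ _ _ FG (fun=> 2 : R) _ _ _ (@cst_cvg (2 : R))
    (eta_over_L eh)) (eta_over_L eh').
  have den := @cvgD _ _ _ _ FG _ _ _ _ rho1 rho1'.
  have two0 : (1 + 1 : R) != 0 by [].
  have := @cvgB _ _ _ _ FG _ (fun=> 1 : R) _ _ (@cvgM _ _ _ FG _ _ _ _ num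
    (@cvgV _ _ _ FG _ _ two0 den)) (@cst_cvg (1 : R)).
  by rewrite !addr0 -(natrD _ 1 1) divff ?subrr.
apply: (@cvg0_le _ _ _ _ _ (fun q => (M * (`|K| + `|K'|)) * `|brk q|)); last first.
  by apply: cvg0_scale; rewrite -(normr0 R); exact: cvg_norm.
near=> q.
have Lq := L_gt0 q.
(* The bounds 1/2 keep the denominator [rho + rho'] away from 0. *)
have rho_gt0 : 1 / 2 < rho q.
  by near: q; apply: (cvgr_gt _ rho1); lra.
have rho_gt0' : 1 / 2 < rho' q.
  by near: q; apply: (cvgr_gt _ rho1'); lra.
have -> : k q * (r x e' q - r x e q) - k q * (e' q - e q) = k q * (e' q - e q) * brk q.
  have rE : r x e q = rho q * L q by rewrite divfK ?gt_eqF.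
  have rE' : r x e' q = rho' q * L q by rewrite divfK ?gt_eqF.
  have sq (f : Q -> R) : r x f q ^+ 2 = ((x q).1 - (ystar q).1) ^+ 2
      + ((x q).2 - (ystar q).2) ^+ 2 + (L q + f q) ^+ 2.
    rewrite /r /norm3 sqr_sqrtr; last by apply: sumr_ge0 => i _; exact: sqr_ge0.
    by rewrite !big_ord_recl big_ord0 !mxE /=; ring.
  have diff : (rho' q * L q - rho q * L q) * (rho' q * L q + rho q * L q) =
      (e' q - e q) * (2 * L q + e q + e' q).
    by have := sq e; have := sq e'; rewrite rE rE'; lra.
  have dr : rho' q * L q - rho q * L q = 
      (e' q - e q) * (2 * L q + e q + e' q) / (rho' q * L q + rho q * L q).
    by rewrite -diff mulfK// gt_eqF// addr_gt0// mulr_gt0//; lra.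
  rewrite rE rE' dr /brk; move: (rho q) (rho' q) rho_gt0 rho_gt0' => z z' z0 z0'.
  have zz : z + z' != 0 by rewrite gt_eqF//; lra.
  have zz' : z' + z != 0 by rewrite gt_eqF//; lra.
  field.
  by rewrite zz -mulrDl (gt_eqF Lq) mulf_neq0// gt_eqF.
rewrite normrM ler_wpM2r//.
have kh : `|k q * h q| <= M by near: q.
have e1 : `|e q| <= K * h q by near: q.
have e2 : `|e' q| <= K' * h q by near: q.
have le_abs (J z : R) : `|z| <= J * h q -> `|z| <= `|J| * `|h q|.
  by move=> zJ; rewrite (le_trans zJ)// -normrM ler_norm.
rewrite normrM (le_trans (ler_wpM2l _ (ler_normB _ _)))//.
rewrite (le_trans (ler_wpM2l _ (lerD (le_abs _ _ e2) (le_abs _ _ e1))))//.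
rewrite -mulrDl mulrCA [leRHS]mulrC addrC ler_wpM2l ?addr_ge0//.
by rewrite -normrM.
Unshelve. all: by end_near. Qed.

End Geometry.

(** * Pointwise limits of the integrands of [Hmx] and [kirchhoff] *)

Section Integrands.
Variable R : realType.

Lemma conjcM (x z : R[i]) : conjc (x * z) = conjc x * conjc z.
Proof. exact: rmorphM. Qed.

Lemma conjc_realV (s : R) : conjc (real_complex R s)^-1 = (real_complex R s)^-1.
Proof. by rewrite -fmorphV /= oppr0. Qed.

Lemma real_complexX (s : R) n : real_complex R (s ^+ n) = real_complex R s ^+ n.
Proof. exact: rmorphXn. Qed.

Lemma conj_mxZ m n (c : R[i]) (A : 'M[R[i]]_(m, n)) :
  conj_mx (c *: A) = conjc c *: conj_mx A.
Proof. by apply/matrixP => i j; rewrite !mxE conjcM. Qed.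

Lemma conjc_expi (s : R) : conjc (expi s) = expi (- s).
Proof. by rewrite /expi cosN sinN. Qed.

Lemma transverse_conj : conj_mx (transverse R) = transverse R.
Proof. by apply/matrixP => i j; rewrite !mxE rmorphMn rmorph_nat. Qed.

Lemma transverse_idem : transverse R *m transverse R = transverse R.
Proof.
rewrite /transverse mul_diag_mx; apply/matrixP => i j; rewrite !mxE.
by case: (i < 2)%N; rewrite ?mul1r ?mul0r ?mul0rn.
Qed.

Lemma block12_transverse : block12 (transverse R) = 1%:M.
Proof.
apply/matrixP => i j; rewrite !mxE /= ltn_ord; congr (_ *+ nat_of_bool _).
Qed.

(** Projecting on both sides erases only the third row and column, so the cross-range block of each
    polarizability survives the imaging intact. *)
Lemma block12_sandwich (A : 'M[R[i]]_3) :
  block12 (transverse R *m A *m transverse R) = block12 A.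
Proof.
rewrite /transverse mul_mx_diag mul_diag_mx; apply/matrixP => i j.
by rewrite !mxE /= !ltn_ord mul1r mulr1.
Qed.

(** The convergent part of the Green dyadic. The phase is split off because it need not converge by
    itself: the phases of several factors are first combined into differences of path lengths. *)
Definition flat_green (X Y : 'cV[R]_3) (k L : R) : 'M[R[i]]_3 :=
  (real_complex R (4 * pi * L) * expi (- (k * norm3 (X - Y)))) *: dyadic_green X Y k.

Lemma four_pi_neq0 (L : R) : 0 < L -> real_complex R (4 * pi * L) != 0.
Proof. by move=> L0; rewrite fmorph_eq0 gt_eqF// !mulr_gt0// pi_gt0. Qed.

Lemma dyadic_greenE (X Y : 'cV[R]_3) (k L : R) : 0 < L ->
  dyadic_green X Y k =
  ((real_complex R (4 * pi * L))^-1 * expi (k * norm3 (X - Y))) *: flat_green X Y k L.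
Proof.
move=> L0; rewrite /flat_green; move: (dyadic_green X Y k) => D.
rewrite scalerA mulrACA mulVf ?four_pi_neq0// mul1r -expiD subrr.
by rewrite /expi cos0 sin0 scale1r.
Qed.

(** The phase is written with [norm3 (X - Y)], as for the direct leg, so that it combines with that
    of the conjugate kernel. *)
Lemma dyadic_green_revE (X Y : 'cV[R]_3) (k L : R) : 0 < L ->
  dyadic_green Y X k =
  ((real_complex R (4 * pi * L))^-1 * expi (k * norm3 (X - Y))) *: flat_green Y X k L.
Proof. by move=> L0; rewrite (norm3B erefl); exact: dyadic_greenE. Qed.

Lemma conj_dyadic_greenE (X Y : 'cV[R]_3) (k L : R) : 0 < L ->
  conj_mx (dyadic_green X Y k) =
  ((real_complex R (4 * pi * L))^-1 * expi (- (k * norm3 (X - Y))))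
    *: conj_mx (flat_green X Y k L).
Proof.
move=> L0; rewrite (dyadic_greenE X Y k L0).
move: (flat_green X Y k L) => D.
by rewrite conj_mxZ conjcM conjc_expi conjc_realV.
Qed.

(** Bookkeeping for the Kirchhoff integrand: [W] stands for [4 pi L], [p1] and [p2] for the phases
    of the two conjugate kernels, [s n] and [t n] for those of the receiver and source legs of
    scatterer [n]. The four amplitudes [W^-1] are absorbed by [W ^ 4]. *)
Lemma scaled_sandwich_sum (N : nat) (W p1 p2 : R[i]) (s t : 'I_N -> R[i])
    (C1 C2 D1 D2 : 'M[R[i]]_3) (A U V E F : 'I_N -> 'M[R[i]]_3) : W != 0 ->
  C1 = (W^-1 * p1) *: D1 -> C2 = (W^-1 * p2) *: D2 ->
  (forall n, U n = (W^-1 * s n) *: E n) -> (forall n, V n = (W^-1 * t n) *: F n) ->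
  W ^+ 4 *: (C1 *m (\sum_n U n *m A n *m V n) *m C2) =
  \sum_n (s n * p1 * (t n * p2)) *: (D1 *m E n *m A n *m F n *m D2).
Proof.
move=> W0 -> -> UE VE; rewrite mulmx_sumr mulmx_suml scaler_sumr.
apply: eq_bigr => n _; rewrite UE VE.
rewrite -!(scalemxAl, scalemxAr) !scalerA !mulmxA; congr (_ *: _).
by field.
Qed.

Variables (Q : Type) (G : set_system Q).
Context {FG : Filter G}.
Variables (k L a b h : Q -> R) (ystar : Q -> R * R) (Kb M : R).
Hypothesis L_gt0 : forall q, 0 < L q.
Hypothesis aL0 : (fun q => a q / L q) @ G --> (0 : R).
Hypothesis bL0 : (fun q => b q / L q) @ G --> (0 : R).
Hypothesis hL0 : (fun q => h q / L q) @ G --> (0 : R).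
Hypothesis kL0 : (fun q => (k q * L q)^-1) @ G --> (0 : R).
Hypothesis kh_le : \forall q \near G, `|k q * h q| <= M.
Hypothesis ystar_le : \forall q \near G, norm2 (ystar q) <= Kb * b q.

Local Notation y e q := (point3 (ystar q) (L q + e q)).
Local Notation flat x e :=
  (fun q => flat_green (array_point (x q)) (y e q) (k q) (L q)).
Local Notation flat_opp x e :=
  (fun q => flat_green (y e q) (array_point (x q)) (k q) (L q)).

Let flat_asym (K : R) (x : Q -> R * R) (e : Q -> R) :
  (\forall q \near G, norm2 (x q) <= a q) ->
  (\forall q \near G, `|e q| <= K * h q) ->
  mxasym G (flat x e) (fun=> transverse R) /\
  mxasym G (flat_opp x e) (fun=> transverse R).
Proof.
move=> xa eh; split.
  have sq1 : (-1 : R) ^+ 2 = 1 by rewrite sqrrN expr1n.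
  apply: (dyadic_green_asym sq1 L_gt0 kL0 _).2.
  exact: (displacement_cvg L_gt0 aL0 bL0 hL0 ystar_le xa eh).
have sq1 : (1 : R) ^+ 2 = 1 by rewrite expr1n.
apply: (dyadic_green_asym sq1 L_gt0 kL0 _).2.
exact: (displacement_opp_cvg L_gt0 aL0 bL0 hL0 ystar_le xa eh).
Qed.

(** The two kernels join the same pair of points, so their phases cancel exactly and the limit is
    the square of a projection. *)
Lemma Hmx_integrand_asym (K : R) (x : Q -> R * R) (e : Q -> R) :
  (\forall q \near G, norm2 (x q) <= a q) ->
  (\forall q \near G, `|e q| <= K * h q) ->
  mxasym G
    (fun q => real_complex R ((4 * pi * L q) ^+ 2) *:
       (conj_mx (dyadic_green (array_point (x q)) (y e q) (k q))
        *m dyadic_green (array_point (x q)) (y e q) (k q)))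
    (fun=> transverse R).
Proof.
move=> xa eh; have [f1 _] := flat_asym xa eh.
pose proof (mxasymM (mxasym_conj f1) f1) as f2.
rewrite transverse_conj transverse_idem in f2.
apply: (mxasym_near _ f2); near=> q.
rewrite (conj_dyadic_greenE _ _ _ (L_gt0 q)) (dyadic_greenE _ _ _ (L_gt0 q)).
move: (norm3 _) (flat_green _ _ _ _) => r D.
rewrite -scalemxAl -scalemxAr !scalerA -[LHS]scale1r; congr (_ *: _).
have <- : expi (- (k q * r)) * expi (k q * r) = 1.
  by rewrite -expiD addNr /expi cos0 sin0.
rewrite real_complexX; have := four_pi_neq0 (L_gt0 q).
by move: (real_complex R _) (expi _) (expi _) => z e1 e2 z0; field.
Unshelve. all: by end_near. Qed.

Variables (N : nat) (eta : 'I_N -> Q -> R) (alpha : 'I_N -> Q -> 'M[R[i]]_3) (A K : R).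
Hypothesis eta_le : forall j, \forall q \near G, `|eta j q| <= K * h q.
Hypothesis alpha_le : forall j, \forall q \near G, frobenius (alpha j q) <= A.

Lemma alpha_asym j : mxasym G (alpha j) (alpha j).
Proof.
move=> i l; apply: (@asym_refl _ _ _ _ _ A); near=> q.
by apply: le_trans (normc_le_frobenius _ _ _) _; near: q.
Unshelve. all: by end_near. Qed.

(** The receiver leg and the source leg each contribute the phase [k (eta n - e)], whence the factor
    2 in the exponent. *)
Lemma kirchhoff_integrand_asym (K' : R) (xr xs : Q -> R * R) (e : Q -> R) :
  (\forall q \near G, norm2 (xr q) <= a q) ->
  (\forall q \near G, norm2 (xs q) <= a q) ->
  (\forall q \near G, `|e q| <= K' * h q) ->
  mxasym G
    (fun q => real_complex R ((4 * pi * L q) ^+ 4) *: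
       (conj_mx (dyadic_green (array_point (xr q)) (y e q) (k q))
        *m array_response (fun j => y (eta j) q) (fun j => alpha j q) (xr q) (xs q) (k q)
        *m conj_mx (dyadic_green (array_point (xs q)) (y e q) (k q))))
    (fun q => \sum_(n < N) expi (2 * (k q * (eta n q - e q))) *:
       (transverse R *m alpha n q *m transverse R)).
Proof.
move=> ra sa eh.
have [re _] := flat_asym ra eh; have [se _] := flat_asym sa eh.
pose r (x : Q -> R * R) (f : Q -> R) q := norm3 (array_point (x q) - y f q).
pose ph (x : Q -> R * R) n q := expi (k q * (r x (eta n) q - r x e q)).
have phE x n : (\forall q \near G, norm2 (x q) <= a q) ->
    asym G (ph x n) (fun q => expi (k q * (eta n q - e q))).
  move=> xa; apply: asym_expi.
  exact: (phase_cvg L_gt0 aL0 bL0 hL0 kL0 ystar_le xa eh (eta_le n) kh_le).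
pose proof (fun n => mxasymZ (asymM (phE xr n ra) (phE xs n sa))
  (mxasymM (mxasymM (mxasymM (mxasymM (mxasym_conj re) (flat_asym ra (eta_le n)).1)
     (alpha_asym n)) (flat_asym sa (eta_le n)).2) (mxasym_conj se))) as term.
pose proof (mxasym_sum term) as f.
rewrite transverse_conj transverse_idem in f; move: f.
have -> : (fun q => \sum_(n < N) (expi (k q * (eta n q - e q)) * expi (k q * (eta n q - e q)))
     *: (transverse R *m alpha n q *m transverse R *m transverse R)) =
    (fun q => \sum_(n < N) expi (2 * (k q * (eta n q - e q))) *:
       (transverse R *m alpha n q *m transverse R)).
  apply/funext => q; apply: eq_bigr => n _.
  by rewrite -expiD -mulmxA transverse_idem mulr_natl mulr2n.
move=> f; apply: (mxasym_near _ f); near=> q.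
rewrite real_complexX /array_response.
pose Xr := array_point (xr q); pose Xs := array_point (xs q).
pose proof (scaled_sandwich_sum (fun n => alpha n q) (four_pi_neq0 (L_gt0 q))
  (conj_dyadic_greenE Xr (y e q) (k q) (L_gt0 q))
  (conj_dyadic_greenE Xs (y e q) (k q) (L_gt0 q))
  (fun n => dyadic_greenE Xr (y (eta n) q) (k q) (L_gt0 q))
  (fun n => dyadic_green_revE Xs (y (eta n) q) (k q) (L_gt0 q))) as sum_flat.
apply: (etrans _ (esym sum_flat)).
apply: eq_bigr => n _; congr (_ *: _).
by rewrite /ph !mulrBr !expiD.
Unshelve. all: by end_near. Qed.

End Integrands.

(** * Passing uniform limits to larger index sets and through integrals *)

Section UniformFilter.
Variables (R : realType) (T : Type) (F : set_system T).
Context {FF : Filter F}.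

Lemma near_uniformly (S : Type) (D : T -> set S) (P : T -> Prop) :
  (\forall t \near F, P t) -> \forall q \near uniformly F D, P q.1.
Proof. by apply: (@filterS _ F) => t Pt s _. Qed.

Lemma near_uniformly_in (S : Type) (D : T -> set S) :
  \forall q \near uniformly F D, D q.1 q.2.
Proof. by apply: (@filterE _ F) => t s Ds. Qed.

(** Meant for a map [phi] that forgets variables: what is uniform in the frequency remains so when
    the imaging range and array points join the index. *)
Lemma near_uniformly_pull (S S' : Type) (D : T -> set S) (D' : T -> set S')
    (phi : S' -> S) (P : T * S -> Prop) :
  (forall t s, D' t s -> D t (phi s)) ->
  (\forall q \near uniformly F D, P q) ->
  \forall q \near uniformly F D', P (q.1, phi q.2).
Proof. by move=> DD'; apply: (@filterS _ F) => t Pt s /DD'; exact: Pt. Qed.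

Lemma cvg_uniformly_pull (S S' : Type) (D : T -> set S) (D' : T -> set S')
    (phi : S' -> S) (u : T * S -> R) (l : R) :
  (forall t s, D' t s -> D t (phi s)) ->
  u @ uniformly F D --> l ->
  (fun q => u (q.1, phi q.2)) @ uniformly F D' --> l.
Proof.
by move=> DD' ul A /ul; exact: (@near_uniformly_pull _ _ _ _ phi (fun q => A (u q))).
Qed.

Section Integral.
Context d (X : measurableType d).
Variables (mu : {measure set X -> \bar R}) (E : T -> set X).
Hypothesis mE : forall t, measurable (E t).
Hypothesis muE_gt0 : forall t, (0 < mu (E t))%E.
Hypothesis muE_fin : forall t, (mu (E t) < +oo)%E.
Variables (S : Type) (D : T -> set S) (w : T -> R).
Hypothesis w_gt0 : forall t, 0 < w t.

Lemma asym_Cintegral (f : T -> S -> X -> R[i]) (v : T -> S -> R[i]) :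
  asym (uniformly F (fun t => [set z : S * X | D t z.1 /\ E t z.2]))
    (fun q => real_complex R (w q.1) * f q.1 q.2.1 q.2.2) (fun q => v q.1 q.2.1) ->
  asym (uniformly F D)
    (fun q => real_complex R (w q.1 / fine (mu (E q.1))) * Cintegral mu (E q.1) (f q.1 q.2))
    (fun q => v q.1 q.2).
Proof.
move=> [[M bv] fv]; split.
  exists M; apply: (@filterS _ F) bv => t bt s Ds.
  (* The bound on [v] is given only at indices that contain a point of [E t]; positive measure
     supplies one. *)
  have [x Ex] : E t !=set0.
    apply/set0P/eqP => E0; have := muE_gt0 t.
    by rewrite E0 measure0 ltxx.
  exact: (bt (s, x)).
move=> eps eps0; have := fv (eps / 2); rewrite divr_gt0// => /(_ isT).
apply: (@filterS _ F) => t ft s Ds /=.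
have -> : eps = 2 * (eps / 2) by field.
apply: Cintegral_near_const => // x Ex.
exact: (ft (s, x)).
Qed.

Lemma mxasym_mxintegral m n (A : T -> S -> X -> 'M[R[i]]_(m, n))
    (B : T -> S -> 'M[R[i]]_(m, n)) :
  mxasym (uniformly F (fun t => [set z : S * X | D t z.1 /\ E t z.2]))
    (fun q => real_complex R (w q.1) *: A q.1 q.2.1 q.2.2) (fun q => B q.1 q.2.1) ->
  mxasym (uniformly F D)
    (fun q => real_complex R (w q.1 / fine (mu (E q.1))) *:
       mxintegral mu (E q.1) (A q.1 q.2))
    (fun q => B q.1 q.2).
Proof.
move=> AB i j.
have entry q : (real_complex R (w q.1 / fine (mu (E q.1))) *:
      mxintegral mu (E q.1) (A q.1 q.2)) i j =
    real_complex R (w q.1 / fine (mu (E q.1)))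
      * Cintegral mu (E q.1) (fun x => A q.1 q.2 x i j).
  by rewrite mxE; congr (_ * _); exact: mxE.
rewrite (funext entry); apply: (@asym_Cintegral (fun t s x => A t s x i j) (fun t s => B t s i j)).
by have := AB i j; under [X in asym _ X _]eq_fun do rewrite mxE.
Qed.

End Integral.
End UniformFilter.

(** * The array disk is measurable, of positive finite area *)

Section Disk.
Variable R : realType.

Lemma measurable_array_disk (a : R) : measurable (array_disk a).
Proof.
have -> : array_disk a = (@norm2 R) @^-1` [set` `]-oo, a]].
  by apply/seteqP; split=> x /=; rewrite in_itv.
rewrite -[X in measurable X]setTI.
suff : measurable_fun setT (@norm2 R) by apply.
apply: measurableT_comp; first by apply: continuous_measurable_fun; exact: sqrt_continuous.
by apply: measurable_funD; apply: measurable_funX; [exact: measurable_fst|exact: measurable_snd].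
Qed.

Let square_measure (r s : R) : r < s ->
  lebesgue2 R (`[r, s]%classic `*` `[r, s]%classic) = ((s - r) * (s - r))%:E.
Proof.
move=> rs; apply: etrans (product_measure1E _ _ _ _) _ => //=.
by rewrite lebesgue_measure_itv /= lte_fin rs -EFinB -EFinM.
Qed.

(** Makes the division by the area legitimate. A square of side [a / 2] with a corner at the centre
    fits in the disk, as [a^2 / 4 + a^2 / 4 <= a^2]. *)
Lemma array_disk_gt0 (a : R) : 0 < a -> (0 < lebesgue2 R (array_disk a))%E.
Proof.
move=> a0; apply: (@lt_le_trans _ _ (lebesgue2 R (`[0, a / 2]%classic `*` `[0, a / 2]%classic))).
  by rewrite square_measure ?divr_gt0// subr0 lte_fin !mulr_gt0.
apply: le_measure; rewrite ?inE; [exact: measurableX|exact: measurable_array_disk|].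
move=> x [] /=; rewrite !in_itv /= => /andP[x1 x2] /andP[x3 x4].
rewrite /array_disk /= /norm2 -[leRHS]gtr0_norm// -sqrtr_sqr ler_wsqrtr//; nra.
Qed.

Lemma array_disk_fin (a : R) : 0 < a -> (lebesgue2 R (array_disk a) < +oo)%E.
Proof.
move=> a0; apply: (@le_lt_trans _ _ (lebesgue2 R (`[- a, a]%classic `*` `[- a, a]%classic))).
  apply: le_measure; rewrite ?inE; [exact: measurable_array_disk|exact: measurableX|].
  move=> x; rewrite /array_disk /= => xa; rewrite !in_itv /= -!ler_norml.
  by rewrite (le_trans (norm2_ge_fst x))// (le_trans (norm2_ge_snd x)).
by rewrite square_measure ?ltry//; lra.
Qed.

End Disk.

(** * Limit of the single-frequency estimate *)

Section SingleFrequency.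
Variables (R : realType) (N : nat) (T : Type) (F : filter_on T).
Variables (c omega0 B L a b h : T -> R) (ystar : T -> R * R).
Variables (eta : 'I_N -> T -> R) (alpha : 'I_N -> T -> 'M[R[i]]_3).
Hypothesis params_gt0 : forall t, [/\ 0 < c t, 0 < B t, 0 < L t &
                               [/\ 0 < a t, 0 < b t & 0 < h t]].
Hypothesis regime : fraunhofer F c omega0 B L a b h.
Variables (Kb Keta A : R).
Hypothesis ystar_le : \forall t \near F, norm2 (ystar t) <= Kb * b t.
Hypothesis eta_le : forall j, \forall t \near F, `|eta j t| <= Keta * h t.
Hypothesis alpha_le : forall j, \forall t \near F, frobenius (alpha j t) <= A.
Variable K : R.

(** The first coordinate is a frequency, the second the range offset of the imaging point. *)
Definition band_window (t : T) : set (R * R) :=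
  [set p | freq_band (omega0 t) (B t) p.1 /\ `|p.2| <= K * h t].

Let L_gt0 t : 0 < L t. Proof. by have [] := params_gt0 t. Qed.
Let a_gt0 t : 0 < a t. Proof. by have [_ _ _ []] := params_gt0 t. Qed.

Section Pullback.
Variables (S : Type) (D : T -> set S) (phi : S -> R * R).
Hypothesis D_window : forall t s, D t s -> band_window t (phi s).
Let G := uniformly F D.
Let D_band t s : D t s -> freq_band (omega0 t) (B t) (phi s).1.
Proof. by move=> /D_window[]. Qed.

(** The regime is given along frequencies only. Here and in the four lemmas below it is carried to
    any index set lying over [band_window], for use with one array point in [Hmx] and two in
    [kirchhoff]. *)
Lemma lift_aL : (fun q : T * S => a q.1 / L q.1) @ G --> (0 : R).
Proof. by have [_ [H _ _] _ _ _] := regime; exact (cvg_uniformly_pull D_band H). Qed.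

Lemma lift_bL : (fun q : T * S => b q.1 / L q.1) @ G --> (0 : R).
Proof. by have [_ [_ H _] _ _ _] := regime; exact (cvg_uniformly_pull D_band H). Qed.

Lemma lift_hL : (fun q : T * S => h q.1 / L q.1) @ G --> (0 : R).
Proof. by have [_ [_ _ H] _ _ _] := regime; exact (cvg_uniformly_pull D_band H). Qed.

Lemma lift_kL : (fun q : T * S => ((phi q.2).1 / c q.1 * L q.1)^-1) @ G --> (0 : R).
Proof.
have [H _ _ _ _] := regime.
refine (cvg_ext _ (cvg_uniformly_pull D_band H)) => q.
by rewrite mul1r.
Qed.

Lemma lift_kh : exists M : R,
  \forall q \near G, `|(phi q.2).1 / c q.1 * h q.1| <= M.
Proof.
have [_ _ _ _ /eqO_exP[M M0 H]] := regime; exists M.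
refine (filterS _ (near_uniformly_pull D_band H)) => q /=.
by rewrite normr1 mulr1.
Qed.

End Pullback.

Local Notation y t e := (point3 (ystar t) (L t + e)).
Let data (t : T) :=
  array_response (fun j => y t (eta j t)) (fun j => alpha j t).
Let m t := fine (lebesgue2 R (array_disk (a t))).

Let m_gt0 t : 0 < m t.
Proof. by rewrite fine_gt0// array_disk_gt0//= array_disk_fin. Qed.

Lemma Hmx_asym :
  mxasym (uniformly F band_window)
    (fun q => real_complex R ((4 * pi * L q.1) ^+ 2 / m q.1) *:
       Hmx (a q.1) (y q.1 q.2.2) (y q.1 q.2.2) (q.2.1 / c q.1))
    (fun=> transverse R).
Proof.
have w_gt0 t : 0 < (4 * pi * L t) ^+ 2 by rewrite exprn_gt0// !mulr_gt0// pi_gt0.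
refine (mxasym_mxintegral (mu := lebesgue2 R) (fun t => measurable_array_disk (a t))
  (fun t => array_disk_gt0 (a_gt0 t)) (fun t => array_disk_fin (a_gt0 t)) w_gt0
  (A := fun t p x => conj_mx (dyadic_green (array_point x) (y t p.2) (p.1 / c t))
     *m dyadic_green (array_point x) (y t p.2) (p.1 / c t))
  (B := fun _ _ => transverse R) _).
set D := fun t => _.
have DW t s : D t s -> band_window t s.1 by case.
(* The array point and the offset are read off as coordinates of the index, which turns the
   pointwise limit into a uniform one. *)
apply: (Hmx_integrand_asym (fun q => L_gt0 q.1) (lift_aL DW) (lift_bL DW)
  (lift_hL DW) (lift_kL DW) (near_uniformly D ystar_le) (K := K)
  (x := fun q => q.2.2) (e := fun q => q.2.1.2)).
  by refine (filterS _ (near_uniformly_in D)) => q [].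
by refine (filterS _ (near_uniformly_in D)) => q [[]].
Qed.

Lemma kirchhoff_asym :
  mxasym (uniformly F band_window)
    (fun q => real_complex R ((4 * pi * L q.1) ^+ 4 / m q.1 / m q.1) *:
       kirchhoff (a q.1) (data q.1) (y q.1 q.2.2) (q.2.1 / c q.1))
    (fun q => \sum_(n < N) expi (2 * (q.2.1 / c q.1 * (eta n q.1 - q.2.2))) *:
       (transverse R *m alpha n q.1 *m transverse R)).
Proof.
have w_gt0 t : 0 < (4 * pi * L t) ^+ 4 by rewrite exprn_gt0// !mulr_gt0// pi_gt0.
have w_gt0' t : 0 < (4 * pi * L t) ^+ 4 / m t by rewrite divr_gt0.
pose integrand t (p : R * R) (xs xr : R * R) : 'M[R[i]]_3 :=
  conj_mx (dyadic_green (array_point xr) (y t p.2) (p.1 / c t))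
  *m data t xr xs (p.1 / c t)
  *m conj_mx (dyadic_green (array_point xs) (y t p.2) (p.1 / c t)).
pose target t (p : R * R) : 'M[R[i]]_3 :=
  \sum_(n < N) expi (2 * (p.1 / c t * (eta n t - p.2))) *:
       (transverse R *m alpha n t *m transverse R).
(* The outer integral over sources is removed first, then the inner one over receivers; each costs
   one division by the area. *)
refine (mxasym_mxintegral (mu := lebesgue2 R) (fun t => measurable_array_disk (a t))
  (fun t => array_disk_gt0 (a_gt0 t)) (fun t => array_disk_fin (a_gt0 t)) w_gt0'
  (A := fun t p xs => mxintegral (lebesgue2 R) (array_disk (a t)) (integrand t p xs))
  (B := target) _).
refine (mxasym_mxintegral (mu := lebesgue2 R) (fun t => measurable_array_disk (a t))
  (fun t => array_disk_gt0 (a_gt0 t)) (fun t => array_disk_fin (a_gt0 t)) w_gt0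
  (A := fun t s xr => integrand t s.1 s.2 xr) (B := fun t s => target t s.1) _).
set D := fun t => _.
have DW t s : D t s -> band_window t s.1.1 by case => -[].
have [M kh] := lift_kh DW.
apply: (kirchhoff_integrand_asym (fun q => L_gt0 q.1) (lift_aL DW) (lift_bL DW)
  (lift_hL DW) (lift_kL DW) kh (near_uniformly D ystar_le)
  (fun j => near_uniformly D (eta_le j)) (fun j => near_uniformly D (alpha_le j))
  (K' := K) (xr := fun q => q.2.2) (xs := fun q => q.2.1.2) (e := fun q => q.2.1.1.2)).
- by refine (filterS _ (near_uniformly_in D)) => q [].
- by refine (filterS _ (near_uniformly_in D)) => q [[]].
- by refine (filterS _ (near_uniformly_in D)) => q [[[]]].
Qed.

Lemma block12Z (z : R[i]) (M : 'M[R[i]]_3) : block12 (z *: M) = z *: block12 M.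
Proof. by apply/matrixP => i j; rewrite !mxE. Qed.

Lemma block12_sum (M : 'I_N -> 'M[R[i]]_3) :
  block12 (\sum_n M n) = \sum_n block12 (M n).
Proof.
apply/matrixP => i j; rewrite !mxE !summxE; apply: eq_bigr => n _.
by rewrite !mxE.
Qed.

(** The scale of [kirchhoff] is the square of the scale [s] of [Hmx], so all scalings cancel in the
    product with two inverses, and the scaled block of [Hmx] tends to the identity. *)
Lemma alpha_freq_asym :
  mxasym (uniformly F band_window)
    (fun q => alpha_freq (a q.1) (data q.1) (y q.1 q.2.2) (q.2.1 / c q.1))
    (fun q => \sum_(n < N) expi (2 * (q.2.1 / c q.1 * (eta n q.1 - q.2.2))) *:
       block12 (alpha n q.1)).
Proof.
pose s t : R := (4 * pi * L t) ^+ 2 / m t.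
pose H q := block12 (Hmx (a q.1) (y q.1 q.2.2) (y q.1 q.2.2) (q.2.1 / c q.1)).
pose I q := block12 (kirchhoff (a q.1) (data q.1) (y q.1 q.2.2) (q.2.1 / c q.1)).
have H1 : mxasym (uniformly F band_window)
    (fun q => real_complex R (s q.1) *: H q) (fun=> 1%:M).
  have := mxasym_block12 Hmx_asym; rewrite block12_transverse.
  by under [X in mxasym _ X _]eq_fun do rewrite block12Z.
have I1 : mxasym (uniformly F band_window)
    (fun q => real_complex R (s q.1 ^+ 2) *: I q)
    (fun q => \sum_(n < N) expi (2 * (q.2.1 / c q.1 * (eta n q.1 - q.2.2))) *:
       block12 (alpha n q.1)).
  have := mxasym_block12 kirchhoff_asym.
  under [X in mxasym _ X _]eq_fun do rewrite block12Z.
  congr mxasym; apply/funext => q.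
    congr (real_complex R _ *: _); rewrite /s; field.
    by rewrite gt_eqF.
  by rewrite block12_sum; apply: eq_bigr => n _; rewrite block12Z block12_sandwich.
pose proof (mxasym_invmx H1) as V1.
pose proof (asym_det H1) as d1; rewrite det1 in d1.
pose proof (mxasymM (mxasymM V1 I1) V1) as VIV.
have -> : (fun q : T * (R * R) =>
    \sum_(n < N) expi (2 * (q.2.1 / c q.1 * (eta n q.1 - q.2.2))) *: block12 (alpha n q.1)) =
    (fun q => 1%:M *m (\sum_(n < N) expi (2 * (q.2.1 / c q.1 * (eta n q.1 - q.2.2)))
      *: block12 (alpha n q.1)) *m 1%:M).
  by apply/funext => q; rewrite mul1mx mulmx1.
apply: (mxasym_near _ VIV); near=> q.
(* Eventual invertibility is what allows the scalar [s] to be pulled out of [invmx]. *)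
have dH : \det (real_complex R (s q.1) *: H q) != 0.
  by near: q; exact: asym1_unit.
rewrite /alpha_freq -/(H q) -/(I q) invmxZ ?unitmxE ?unitfE//.
have s0 : real_complex R (s q.1) != 0.
  by rewrite fmorph_eq0 gt_eqF// divr_gt0// exprn_gt0// !mulr_gt0// pi_gt0.
rewrite real_complexX; move: (real_complex R _) (invmx _) (I q) s0 => z V J z0.
rewrite -!(scalemxAl, scalemxAr) !scalerA -[RHS]scale1r; congr (_ *: _).
by field.
Unshelve. all: by end_near. Qed.

End SingleFrequency.

(** * Linearity of the complex integral *)

Section ComplexIntegralLinear.
Context d (X : measurableType d) (R : realType).
Variables (mu : {measure set X -> \bar R}) (D : set X).
Hypothesis mD : measurable D.

Lemma integrable_mulr (f : X -> R) (r : R) : mu.-integrable D (EFin \o f) ->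
  mu.-integrable D (EFin \o (fun x => f x * r)).
Proof. by move=> fi; have := integrableZr mD r fi. Qed.

Definition Cintegrable (f : X -> R[i]) : Prop :=
  mu.-integrable D (EFin \o (fun x => complex.Re (f x))) /\
  mu.-integrable D (EFin \o (fun x => complex.Im (f x))).

Lemma CintegrableMr (f : X -> R[i]) (z : R[i]) :
  Cintegrable f -> Cintegrable (fun x => f x * z).
Proof.
move=> [rf jf]; case: z => u v; split.
  have := integrableB mD (integrableZr mD u rf) (integrableZr mD v jf).
  by congr (integrable _ _ _); apply/funext => x /=; case: (f x).
have := integrableD mD (integrableZr mD v rf) (integrableZr mD u jf).
by congr (integrable _ _ _); apply/funext => x /=; case: (f x).
Qed.

Lemma CintegralMr (f : X -> R[i]) (z : R[i]) : Cintegrable f ->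
  Cintegral mu D (fun x => f x * z) = Cintegral mu D f * z.
Proof.
move=> [rf jf]; case: z => u v; rewrite /Cintegral; apply/eqP; rewrite eq_complex /=.
apply/andP; split; apply/eqP.
  rewrite -!RintegralZr// -RintegralB//; try exact: integrable_mulr.
  by apply: eq_Rintegral => x _; case: (f x).
rewrite -!RintegralZr// -RintegralD//; try exact: integrable_mulr.
by apply: eq_Rintegral => x _; case: (f x).
Qed.

Lemma CintegrableD (f g : X -> R[i]) :
  Cintegrable f -> Cintegrable g -> Cintegrable (fun x => f x + g x).
Proof.
move=> [rf jf] [rg jg]; split.
  have := integrableD mD rf rg.
  by congr (integrable _ _ _); apply/funext => x /=; case: (f x); case: (g x).
have := integrableD mD jf jg.
by congr (integrable _ _ _); apply/funext => x /=; case: (f x); case: (g x).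
Qed.

Lemma CintegralD (f g : X -> R[i]) : Cintegrable f -> Cintegrable g ->
  Cintegral mu D (fun x => f x + g x) = Cintegral mu D f + Cintegral mu D g.
Proof.
move=> [rf jf] [rg jg]; rewrite /Cintegral; apply/eqP; rewrite eq_complex /=.
apply/andP; split; apply/eqP; rewrite -RintegralD//.
  by apply: eq_Rintegral => x _; case: (f x); case: (g x).
by apply: eq_Rintegral => x _; case: (f x); case: (g x).
Qed.

(** Integrability is proved along with the formula because the inductive step needs it for the
    tail. *)
Lemma Cintegral_sum (I : Type) (s : seq I) (f : I -> X -> R[i]) :
  (forall i, Cintegrable (f i)) ->
  Cintegrable (fun x => \sum_(i <- s) f i x) /\
  Cintegral mu D (fun x => \sum_(i <- s) f i x) = \sum_(i <- s) Cintegral mu D (f i).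
Proof.
move=> fi; elim: s => [|i s [IH1 IH2]].
  have -> : (fun x => \sum_(i <- [::]) f i x) = fun=> 0.
    by apply/funext => x; rewrite big_nil.
  rewrite big_nil; split.
    by split; exact: (integrable0 mu D).
  by rewrite /Cintegral /= !Rintegral_cst// mul0r.
have -> : (fun x => \sum_(j <- i :: s) f j x) = fun x => f i x + \sum_(j <- s) f j x.
  by apply/funext => x; rewrite big_cons.
split; first exact: CintegrableD.
by rewrite CintegralD// big_cons IH2.
Qed.

End ComplexIntegralLinear.

(** * Mean of an oscillating phase over the band *)

Section BandAverage.
Variable R : realType.
Local Notation mu := (@lebesgue_measure R).

Definition open_band (omega0 B : R) : set R := [set omega | `|omega - omega0| < B / 2].

Lemma open_bandE (omega0 B : R) :
  open_band omega0 B = `]omega0 - B / 2, omega0 + B / 2[%classic.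
Proof.
by apply/seteqP; split => x /=; rewrite in_itv /= /open_band /= ltr_distl.
Qed.

Lemma measurable_open_band (omega0 B : R) :
  measurable (open_band omega0 B : set (measurableTypeR R)).
Proof. by rewrite open_bandE. Qed.

Lemma open_band_measure (omega0 B : R) : 0 < B -> mu (open_band omega0 B) = B%:E.
Proof.
move=> B0; rewrite open_bandE lebesgue_measure_itv /= lte_fin.
have -> : omega0 - B / 2 < omega0 + B / 2 by lra.
by rewrite -EFinB; congr EFin; lra.
Qed.

Lemma integrable_band_bounded (omega0 B : R) (f : R -> R) : 0 < B ->
  continuous f -> (forall x, `|f x| <= 1) ->
  mu.-integrable (open_band omega0 B) (EFin \o f).
Proof.
move=> B0 cf f1; apply: measurable_bounded_integrable.
- exact: measurable_open_band.
- by have /= -> := open_band_measure omega0 B0; rewrite ltry.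
- by apply: measurable_funTS; exact: continuous_measurable_fun.
- exists 1; split; first exact: num_real.
  by move=> M M1 x _; exact: le_trans (f1 x) (ltW M1).
Qed.

(** The fundamental theorem of calculus is applied on the closed interval, which differs from the
    open band by a null set; the bound on [f] provides integrability. *)
Lemma band_primitive (omega0 B : R) (f F : R -> R) : 0 < B ->
  continuous f -> (forall x, `|f x| <= 1) -> (forall x : R, is_derive x (1 : R) F (f x)) ->
  \int[mu]_(x in open_band omega0 B) f x = F (omega0 + B / 2) - F (omega0 - B / 2).
Proof.
move=> B0 cf f1 dF; have lu : omega0 - B / 2 < omega0 + B / 2 by lra.
have fi := integrable_band_bounded omega0 B0 cf f1.
have cF : continuous F.
  by move=> x; apply: differentiable_continuous; apply/derivable1_diffP; case: (dF x).
rewrite open_bandE in fi *.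
rewrite Rintegral_itv_obnd_cbnd//.
have mf : measurable_fun setT f by exact: continuous_measurable_fun.
rewrite /Rintegral integral_itv_bndo_bndc; last first.
  by apply/measurable_EFinP; exact: measurable_funTS.
rewrite (continuous_FTC2 lu (F := F))//.
- exact: continuous_subspaceT.
- split => [x _||]; first by case: (dF x).
    exact: cvg_at_right_filter (cF _).
  exact: cvg_at_left_filter (cF _).
- by move=> x _; rewrite derive1E; case: (dF x).
Qed.

(** A modulated sinc: for positive [B], [c] and nonzero [delta] it equals
    [expi (2 omega0 delta / c)] times [sin x / x] with [x = B delta / c]. *)
Definition band_average (c omega0 B delta : R) : R[i] :=
  real_complex R B^-1 *
  Cintegral mu (open_band omega0 B) (fun omega => expi (2 * (omega / c * delta))).

Let phaseE (c delta omega : R) : 2 * (omega / c * delta) = (2 * delta / c) * omega.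
Proof. by ring. Qed.

Lemma Cintegrable_phase (c omega0 B delta : R) : 0 < B ->
  Cintegrable mu (open_band omega0 B) (fun omega => expi (2 * (omega / c * delta))).
Proof.
move=> B0; split; apply: integrable_band_bounded => //=.
- under eq_fun do rewrite phaseE.
  move=> x; apply: continuous_comp; last exact: continuous_cos.
  exact: mulrl_continuous.
- by move=> x; exact: cos_max.
- under eq_fun do rewrite phaseE.
  move=> x; apply: continuous_comp; last exact: continuous_sin.
  exact: mulrl_continuous.
- by move=> x; exact: sin_max.
Qed.

Lemma band_average0 (c omega0 B : R) : 0 < B -> band_average c omega0 B 0 = 1.
Proof.
move=> B0; rewrite /band_average.
have -> : (fun omega => expi (2 * (omega / c * 0))) = fun=> 1 :> R[i].
  by apply/funext => w; rewrite !mulr0 /expi cos0 sin0.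
rewrite /Cintegral !Rintegral_cst; [|exact: measurable_open_band..].
have /= -> := open_band_measure omega0 B0.
rewrite mul1r mul0r -[Complex B 0]/(real_complex R B) fmorphV mulVf//.
by rewrite fmorph_eq0 gt_eqF.
Qed.

(** With [kappa = 2 delta / c], the primitives of the cosine and sine parts are bounded by
    [1 / |kappa|], so each varies by at most [2 / |kappa| = c / |delta|]. Adding the two parts gives
    the factor 2. *)
Lemma band_average_le (c omega0 B delta : R) : 0 < B -> 0 < c -> delta != 0 ->
  normc (band_average c omega0 B delta) <= 2 * (c / (B * `|delta|)).
Proof.
move=> B0 c0 d0; pose kappa := 2 * delta / c.
have k0 : kappa != 0 by rewrite /kappa !mulf_neq0 ?invr_neq0 ?(gt_eqF c0).
have lincont : continuous (fun x : R => kappa * x) by exact: mulrl_continuous.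
have csin : continuous (fun x : R => sin (kappa * x)).
  by move=> x; apply: continuous_comp; [exact: lincont|exact: continuous_sin].
have ccos : continuous (fun x : R => cos (kappa * x)).
  by move=> x; apply: continuous_comp; [exact: lincont|exact: continuous_cos].
have dcos (x : R) : is_derive x (1 : R) (fun x : R => kappa^-1 * sin (kappa * x)) (cos (kappa * x)).
  apply: is_derive_eq; rewrite -![_ *: _]/(_ * _).
  by move: (cos _) => w; field.
have dsin (x : R) : is_derive x (1 : R)
    (fun x : R => - (kappa^-1 * cos (kappa * x))) (sin (kappa * x)).
  apply: is_derive_eq; rewrite -![_ *: _]/(_ * _).
  by move: (sin _) => w; field.
have bound (F : R -> R) u v : (forall x, `|F x| <= 1) ->
    `|kappa^-1 * F u - kappa^-1 * F v| <= c / `|delta|.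
  move=> F1; rewrite -mulrBr normrM /kappa.
  rewrite normfV !normrM normfV (gtr0_norm c0) (ger0_norm (ler0n _ 2)).
  have h : `|F u - F v| <= 2.
    by rewrite (le_trans (ler_normB _ _))// -[2]/(1 + 1) lerD.
  apply: le_trans (ler_wpM2l _ h) _; first by rewrite invr_ge0 divr_ge0// ltW.
  rewrite le_eqVlt; apply/orP; left; apply/eqP; field.
  by rewrite (gt_eqF c0) normr_eq0 d0.
rewrite /band_average ComplexField.Normc.normcM normc_real gtr0_norm ?invr_gt0//.
have -> : 2 * (c / (B * `|delta|)) = B^-1 * (c / `|delta| + c / `|delta|).
  by field; rewrite normr_eq0 d0 gt_eqF.
rewrite ler_pM2l ?invr_gt0//.
apply: le_trans (ler_normc_ReIm _) _; rewrite /Cintegral /=.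
under eq_Rintegral do rewrite phaseE.
under [X in _ + `|X|]eq_Rintegral do rewrite phaseE.
rewrite (band_primitive omega0 B0 ccos _ dcos); last by move=> x; exact: cos_max.
rewrite (band_primitive omega0 B0 csin _ dsin); last by move=> x; exact: sin_max.
rewrite lerD//; first by apply: bound => x; exact: sin_max.
by rewrite -opprD normrN; apply: bound => x; exact: cos_max.
Qed.

End BandAverage.

(** * The range term and the splitting into O and o(1) *)

Section RangeTerm.
Variables (R : realType) (N : nat).

Lemma range_term_ge0 (c B : R) (P : pred 'I_N) (d : 'I_N -> R) :
  0 < c -> 0 < B -> (forall j, 0 <= d j) -> 0 <= range_term c B P d.
Proof.
move=> c0 B0 d0; rewrite /range_term; case: pickP => // j _.
by rewrite divr_ge0 ?(ltW c0)// mulr_ge0 ?(ltW B0).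
Qed.

(** The smallest distance yields the largest quotient, so a single term dominates the contribution
    of every scatterer in [P]. *)
Lemma le_range_term (c B : R) (P : pred 'I_N) (d : 'I_N -> R) j :
  0 < c -> 0 < B -> (forall i, P i -> 0 < d i) -> P j ->
  c / (B * d j) <= range_term c B P d.
Proof.
move=> c0 B0 d0 Pj; rewrite /range_term; case: pickP => [j0 Pj0|/(_ j)]; last by rewrite Pj.
case: arg_minP => // i Pi imin; rewrite ler_pM2l// lef_pV2 ?posrE ?mulr_gt0 ?d0//.
by rewrite ler_pM2l// imin.
Qed.

(** The part of [f] below [M g] is taken as the O-term; the excess is eventually below every
    [eps]. *)
Lemma O_plus_o1_le (S : Type) (G : filter_on S) (f g : S -> R) (M : R) :
  (forall p, 0 <= f p) -> (forall p, 0 <= g p) -> 0 <= M ->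
  (forall eps, 0 < eps -> \forall p \near G, f p <= M * g p + eps) ->
  O_plus_o1 G f g.
Proof.
move=> f0 g0 M0 fg.
exists (fun p => Num.min (f p) (M * g p)), (fun p => f p - Num.min (f p) (M * g p)).
split.
- by apply/funext => p /=; rewrite addrC subrK.
(* The O-constant must be positive whereas [M] may be 0. *)
- apply/eqO_exP; exists (M + 1); first by rewrite ltr_wpDl.
  near=> p; rewrite !ger0_norm ?le_min ?f0 ?mulr_ge0//.
  by rewrite ge_min mulrDl mul1r lerDl g0 orbT.
- apply/eqoP => e e0; near=> p.
  have fp : f p <= M * g p + e by near: p; exact: fg.
  rewrite normr1 mulr1 ger0_norm; last by rewrite subr_ge0 ge_min lexx.
  rewrite minElt; case: ifP => _; first by rewrite subrr ltW.
  by rewrite lerBlDl.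
Unshelve. all: by end_near. Qed.

End RangeTerm.

(** * Estimates for the band-averaged image *)

Section BandEstimate.
Variables (R : realType) (N : nat) (T : Type) (F : filter_on T).
Variables (c omega0 B L a b h : T -> R) (ystar : T -> R * R).
Variables (eta : 'I_N -> T -> R) (alpha : 'I_N -> T -> 'M[R[i]]_3).
Hypothesis params_gt0 : forall t, [/\ 0 < c t, 0 < B t, 0 < L t &
                               [/\ 0 < a t, 0 < b t & 0 < h t]].
Hypothesis regime : fraunhofer F c omega0 B L a b h.
Variables (Kb Keta A : R).
Hypothesis ystar_le : \forall t \near F, norm2 (ystar t) <= Kb * b t.
Hypothesis eta_le : forall j, \forall t \near F, `|eta j t| <= Keta * h t.
Hypothesis alpha_le : forall j, \forall t \near F, frobenius (alpha j t) <= A.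

Let y (t : T) (e : R) := point3 (ystar t) (L t + e).
Let data (t : T) :=
  array_response (fun j => y t (eta j t)) (fun j => alpha j t).
Let alpha12 (t : T) (e : R) :=
  alpha_band (c t) (omega0 t) (B t) (a t) (data t) (y t e).

Let B_gt0 t : 0 < B t. Proof. by have [] := params_gt0 t. Qed.
Let c_gt0 t : 0 < c t. Proof. by have [] := params_gt0 t. Qed.

(** The single-frequency limit is uniform in the frequency, hence survives averaging; the averaged
    limit is then split term by term. *)
Lemma alpha_band_near (K eps : R) : 0 < eps ->
  \forall t \near F, forall e, `|e| <= K * h t -> forall i j,
  normc (alpha12 t e i j
    - \sum_n band_average (c t) (omega0 t) (B t) (eta n t - e) * block12 (alpha n t) i j)
  <= eps.
Proof.
move=> eps0; have eps20 : 0 < eps / 2 by rewrite divr_gt0.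
have near_ij i j : \forall t \near F, forall p, band_window omega0 B h K t p ->
    normc (alpha_freq (a t) (data t) (y t p.2) (p.1 / c t) i j -
      (\sum_n expi (2 * (p.1 / c t * (eta n t - p.2))) *: block12 (alpha n t)) i j)
    <= eps / 2.
  have [_ lim] := alpha_freq_asym params_gt0 regime ystar_le eta_le alpha_le K i j.
  by refine (@filterS _ F _ _ _ _ (lim _ eps20)) => t close p /close.
refine (filterS _ (filter_forall _ (fun i => filter_forall _ (near_ij i)))).
move=> t close e eK i j.
rewrite /alpha12 /alpha_band !mxE.
have phase_int n : Cintegrable (@lebesgue_measure R) (open_band (omega0 t) (B t))
    (fun omega => expi (2 * (omega / c t * (eta n t - e)))).
  exact: Cintegrable_phase.
pose g omega := \sum_n expi (2 * (omega / c t * (eta n t - e))) * block12 (alpha n t) i j.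
have [gi gE] := Cintegral_sum (measurable_open_band (omega0 t) (B t)) (index_enum 'I_N)
  (fun n => CintegrableMr (measurable_open_band (omega0 t) (B t))
     (block12 (alpha n t) i j) (phase_int n)).
have -> : \sum_n band_average (c t) (omega0 t) (B t) (eta n t - e) * block12 (alpha n t) i j
    = real_complex R (B t)^-1 * Cintegral (@lebesgue_measure R) (open_band (omega0 t) (B t)) g.
  rewrite gE mulr_sumr; apply: eq_bigr => n _; rewrite CintegralMr ?mulrA//.
  exact: measurable_open_band.
rewrite -mulrBr ComplexField.Normc.normcM normc_real gtr0_norm ?invr_gt0//.
rewrite ler_pdivrMl//.
have mB := open_band_measure (omega0 t) (B_gt0 t).
have fin : (lebesgue_measure (open_band (omega0 t) (B t)) < +oo)%E.
  by have /= -> := mB; rewrite ltry.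
have -> : B t * eps = 2 * (eps / 2) * fine (lebesgue_measure (open_band (omega0 t) (B t))).
  by have /= -> := mB; rewrite /=; field.
apply: Cintegral_dist => //.
- exact: measurable_open_band.
- by case: gi.
- by case: gi.
(* The average runs over the open band, while the regime is uniform on the closed one. *)
move=> omega; rewrite /= ltr_distl => /andP[/ltW h1 /ltW h2].
have := close i j (omega, e); rewrite /band_window /freq_band /= h1 h2 eK => /(_ (conj isT isT)).
by congr (normc (_ - _) <= _); rewrite summxE; apply: eq_bigr => n _; rewrite mxE.
Qed.

(** Treats both estimates at once: [P] is [j != i] in the first and always true in the second.
    Scatterers outside [P] sit at offset [x], so their mean phase is exactly 1 and they are
    subtracted. In the constant, 4 counts matrix entries, [N] scatterers, 2 is that of
    [band_average_le], and [A] bounds the polarizabilities. *)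
Lemma frobenius_band_le (P : pred 'I_N) (e : T -> set R) (K eps : R) : 0 < eps ->
  0 <= A ->
  (forall t x, e t x -> `|x| <= K * h t /\ forall j, P j = (eta j t != x)) ->
  \forall t \near F, forall x, e t x ->
  frobenius (alpha12 t x - \sum_(n | ~~ P n) block12 (alpha n t))
  <= 4 * (2 * N%:R * A) * range_term (c t) (B t) P (fun j => `|x - eta j t|) + eps.
Proof.
move=> eps0 A0 eP; have eps40 : 0 < eps / 4 by rewrite divr_gt0.
have alphaA : \forall t \near F, forall j, frobenius (alpha j t) <= A.
  exact: filter_forall.
near=> t; move=> x ex; have [xK Px] := eP t x ex.
have close : forall e, `|e| <= K * h t -> forall i j,
  normc (alpha12 t e i j
    - \sum_n band_average (c t) (omega0 t) (B t) (eta n t - e) * block12 (alpha n t) i j)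
  <= eps / 4 by near: t; exact: alpha_band_near.
have At : forall j, frobenius (alpha j t) <= A by near: t.
set g := range_term _ _ _ _.
have g_ge n : P n -> c t / (B t * `|x - eta n t|) <= g.
  move=> Pn; apply: (@le_range_term _ _ _ _ P (fun j => `|x - eta j t|)) => //.
  by move=> j; rewrite Px normr_gt0 subr_eq0 eq_sym.
have g0 : 0 <= g by exact: range_term_ge0.
have entry i j : normc ((alpha12 t x - \sum_(n | ~~ P n) block12 (alpha n t)) i j) <=
    2 * N%:R * A * g + eps / 4.
  rewrite mxE [X in _ + X]mxE summxE.
  pose J n := band_average (c t) (omega0 t) (B t) (eta n t - x).
  have -> : \sum_(n | ~~ P n) block12 (alpha n t) i j =
      \sum_(n | ~~ P n) J n * block12 (alpha n t) i j.
    apply: eq_bigr => n; rewrite Px negbK => /eqP nx.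
    by rewrite /J nx subrr band_average0// mul1r.
  rewrite -(subrKA (\sum_n J n * block12 (alpha n t) i j)).
  rewrite (le_trans (le_normcD _ _))// addrC lerD//; last exact: close.
  rewrite (bigID P) /= addrK (le_trans (normc_sum _ _ _))//.
  have -> : 2 * N%:R * A * g = \sum_(n < N) 2 * g * A.
    by rewrite sumr_const card_ord -[RHS]mulr_natr; ring.
  rewrite [leRHS](bigID P) /= -[leLHS]addr0 lerD//; last first.
    by apply: sumr_ge0 => n _; rewrite !mulr_ge0.
  apply: ler_sum => n Pn; rewrite ComplexField.Normc.normcM ler_pM ?normc_ge0//.
    have nx : eta n t - x != 0 by rewrite subr_eq0 -Px.
    apply: le_trans (band_average_le _ _ _ nx) _ => //.
    by rewrite ler_pM2l// distrC g_ge.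
  by rewrite 2!mxE (le_trans (normc_le_frobenius _ _ _)).
apply: le_trans (frobenius_le_sum _) _.
apply: (@le_trans _ _ (\sum_(i < 2) \sum_(j < 2) (2 * N%:R * A * g + eps / 4))).
  by apply: ler_sum => i _; apply: ler_sum => j _; exact: entry.
by rewrite !sumr_const !card_ord; rewrite le_eqVlt; apply/orP; left; apply/eqP; field.
Unshelve. all: by end_near. Qed.

End BandEstimate.

(** There are finitely many indices, so the sum of the individual constants serves them all. *)
Lemma eqO_uniform_bound (R : realType) (N : nat) (T : Type) (F : filter_on T)
    (f : 'I_N -> T -> R) (g : T -> R) : (forall j, f j =O_F g) ->
  exists2 C : R, 0 <= C & forall j, \forall t \near F, `|f j t| <= C * `|g t|.
Proof.
move=> fg.
have /choice[C CP] : forall j, exists C : R, 0 < C /\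
    \forall t \near F, `|f j t| <= C * `|g t|.
  by move=> j; have /eqO_exP[C C0 H] := fg j; exists C.
exists (\sum_j C j); first by apply: sumr_ge0 => j _; case: (CP j) => /ltW.
move=> j; have [_] := CP j; apply: filterS => t /le_trans; apply.
rewrite ler_wpM2r// (bigD1 j)//= lerDl sumr_ge0// => i _.
by case: (CP i) => /ltW.
Qed.

Theorem proposition3p4 (R : realType) (N : nat) (T : Type) (F : filter_on T)
    (c omega0 B L a b h : T -> R) (ystar : T -> R * R)
    (eta : 'I_N -> T -> R) (alpha : 'I_N -> T -> 'M[R[i]]_3)
    (N_gt0 : (0 < N)%N)
    (params_gt0 : forall t, [/\ 0 < c t, 0 < B t, 0 < L t &
                               [/\ 0 < a t, 0 < b t & 0 < h t]])
    (band_gt0 : forall t, 0 < omega0 t - B t / 2)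
    (regime : fraunhofer F c omega0 B L a b h)
    (ystar_window : (fun t => norm2 (ystar t)) =O_F b)
    (eta_window : forall j, eta j =O_F h)
    (eta_distinct : forall t i j, i != j -> eta i t != eta j t)
    (alpha_sym : forall j t, (alpha j t)^T = alpha j t)
    (alpha_bounded : forall j, (fun t => frobenius (alpha j t)) =O_F (fun=> 1 : R)) :
  let y (t : T) (e : R) := point3 (ystar t) (L t + e) in
  let data (t : T) :=
    array_response (fun j => y t (eta j t)) (fun j => alpha j t) in
  let alpha12 (t : T) (e : R) :=
    alpha_band (c t) (omega0 t) (B t) (a t) (data t) (y t e) in
  (forall i,
     O_plus_o1 F
       (fun t => frobenius (alpha12 t (eta i t) - block12 (alpha i t)))
       (fun t => range_term (c t) (B t) (fun j => j != i)
                   (fun j => `|eta i t - eta j t|)))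
  /\
  (forall K : R,
     O_plus_o1
       (uniformly_filter_on F (fun t : T =>
          [set e : R | `|e| <= K * h t /\ forall j, y t e <> y t (eta j t)]))
       (fun p : T * R => frobenius (alpha12 p.1 p.2))
       (fun p : T * R => range_term (c p.1) (B p.1) xpredT
                   (fun j => `|p.2 - eta j p.1|))).
Proof.
move=> y data alpha12.
have h_gt0 t : 0 < h t by have [_ _ _ []] := params_gt0 t.
have c_gt0 t : 0 < c t by have [] := params_gt0 t.
have B_gt0 t : 0 < B t by have [] := params_gt0 t.
have [Kb ystar_le] : exists Kb, \forall t \near F, norm2 (ystar t) <= Kb * b t.
  have /eqO_exP[Kb _ yb] := ystar_window; exists Kb; apply: filterS yb => t.
  have b0 : 0 < b t by have [_ _ _ []] := params_gt0 t.
  by rewrite (gtr0_norm b0) => /(le_trans (ler_norm _)).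
have [Keta _ eta_le'] := eqO_uniform_bound eta_window.
have eta_le j : \forall t \near F, `|eta j t| <= Keta * h t.
  by apply: filterS (eta_le' j) => t; rewrite (gtr0_norm (h_gt0 t)).
have [A A0 alpha_le'] := eqO_uniform_bound alpha_bounded.
have alpha_le j : \forall t \near F, frobenius (alpha j t) <= A.
  by apply: filterS (alpha_le' j) => t; rewrite normr1 mulr1 => /(le_trans (ler_norm _)).
have bound := frobenius_band_le params_gt0 regime ystar_le eta_le alpha_le.
have M0 : 0 <= 4 * (2 * N%:R * A) by rewrite !mulr_ge0.
split=> [i|K].
  apply: (O_plus_o1_le (M := 4 * (2 * N%:R * A))) => //.
  - by move=> t; exact: frobenius_ge0.
  - by move=> t; exact: range_term_ge0.
  move=> eps eps0.
  (* The singleton of [eta i t] is cut by the window bound because that bound holds only eventually,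
     while [frobenius_band_le] asks for it at every [t]. *)
  have eP t x : [set x | x = eta i t /\ `|x| <= Keta * h t] x ->
      `|x| <= Keta * h t /\ forall j, (j != i) = (eta j t != x).
    move=> [-> le]; split => // j; have [->|ji] := eqVneq j i; first by rewrite eqxx.
    by rewrite eta_distinct.
  near=> t.
  have ie : `|eta i t| <= Keta * h t by near: t; exact: eta_le.
  have : forall x, x = eta i t /\ `|x| <= Keta * h t ->
    frobenius (alpha12 t x - \sum_(n | ~~ (n != i)) block12 (alpha n t))
    <= 4 * (2 * N%:R * A) * range_term (c t) (B t) (fun j => j != i)
         (fun j => `|x - eta j t|) + eps.
    by near: t; exact: (bound _ _ _ _ eps0 A0 eP).
  move=> /(_ _ (conj erefl ie)).
  by rewrite (big_pred1 i)// => j; rewrite negbK.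
apply: (O_plus_o1_le (M := 4 * (2 * N%:R * A))) => //.
- by move=> p; exact: frobenius_ge0.
- by move=> p; exact: range_term_ge0.
move=> eps eps0.
(* Equal offsets would give equal points, so avoiding all scatterers forces [x] to differ from every
   [eta j t]. *)
have eP t x : [set e : R | `|e| <= K * h t /\ forall j, y t e <> y t (eta j t)] x ->
    `|x| <= K * h t /\ forall j, true = (eta j t != x).
  move=> [le ne]; split => // j; apply/esym/eqP => ej.
  by apply: (ne j); rewrite ej.
apply: (@filterS _ F) (bound _ _ _ _ eps0 A0 eP) => t close x ex /=.
by have := close x ex; rewrite big_pred0// subr0.
Unshelve. all: by end_near. Qed.
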